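(* Let $d \ge 1$, and for $0<r<1$ let $\alpha_r(\cdot)$ be the quenched Lyapunov exponent of the simple random walk on $\mathbb{Z}^d$ in the Bernoulli potential with parameter $r$. Then the following hold. (1) For all $0<p<q<1$, $$\inf_{x \in \mathbb{R}^d\setminus\{0\}}\frac{\alpha_p(x)-\alpha_q(x)}{\|x\|_1} \ge (1-e^{-1})(q-p).$$ (2) Let $0<q_0<1$. Then there exists a constant $0<C<\infty$ (which may depend on $d$ and $q_0$) such that for all $0<p<q\le q_0$, $$\sup_{x \in \mathbb{R}^d\setminus\{0\}}\frac{\alpha_p(x)-\alpha_q(x)}{\|x\|_1} \le C(q-p).$$
   Context: $(S_k)_{k\ge0}$ is the simple (symmetric nearest-neighbor) random walk on $\mathbb{Z}^d$; $P^x$, $E^x$ are its law and expectation when started at $x$. $H(y):=\inf\{k\ge 0: S_k=y\}$. For a potential $\omega=(\omega(x))_{x\in\mathbb{Z}^d}\in[0,\infty)^{\mathbb{Z}^d}$, define $$e(x,y,\omega):=E^x\Bigl[\exp\Bigl\{-\sum_{k=0}^{H(y)-1}\omega(S_k)\Bigr\}\mathbf{1}_{\{H(y)<\infty\}}\Bigr]$$ (with $e(x,x,\omega)=1$) and the quenched travel cost $a(x,y,\omega):=-\log e(x,y,\omega)$. For $0\le r\le 1$, $\mathbb{P}_r$ (expectation $\mathbb{E}_r$) is the law, independent of the walk, under which the $\omega(x)$, $x\in\mathbb{Z}^d$, are i.i.d. with $\mathbb{P}_r(\omega(x)=0)=1-\mathbb{P}_r(\omega(x)=1)=r$; then $\omega$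 is called the Bernoulli potential with parameter $r$. The quenched Lyapunov exponent $\alpha_r(\cdot)$ is the (nonrandom) norm on $\mathbb{R}^d$ determined by $\alpha_r(x)=\lim_{n\to\infty}\frac1n\mathbb{E}_r[a(0,nx,\omega)]=\inf_{n\in\mathbb{N}}\frac1n\mathbb{E}_r[a(0,nx,\omega)]$ for all $x\in\mathbb{Z}^d$ (it is known that such a norm exists, and that $\frac1n a(0,nx,\omega)\to\alpha_r(x)$ $\mathbb{P}_r$-a.s. and in $L^1(\mathbb{P}_r)$). $\|\cdot\|_1$ is the $\ell^1$-norm on $\mathbb{R}^d$. *)

(* Defs.v *)
From HB Require Import structures.
From mathcomp Require Import all_boot all_order all_algebra.
From mathcomp Require Import all_classical all_reals all_analysis.

Set Implicit Arguments.
Unset Strict Implicit.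
Unset Printing Implicit Defensive.

Import Order.TTheory GRing.Theory Num.Theory.
Import numFieldNormedType.Exports.

Local Open Scope classical_set_scope.
Local Open Scope ring_scope.

(* Points of Z^d and R^d are row vectors of type 'rV[int]_d and 'rV[R]_d. *)

Definition l1norm (K : numDomainType) (d : nat) (x : 'rV[K]_d) : K :=
  \sum_(i < d) `|x 0 i|.

Record is_norm (R : realType) (d : nat) (N : 'rV[R]_d -> R) : Prop := IsNorm {
  is_norm_triangle : forall x y, N (x + y) <= N x + N y ;
  is_norm_homogeneous : forall (c : R) x, N (c *: x) = `|c| * N x ;
  is_norm_definite : forall x, N x = 0 -> x = 0 }.

Definition srw_step (R : realType) (d : nat) (u v : 'rV[int]_d) : R :=
  if l1norm (v - u) == 1 then (2 * d)%:R^-1 else 0.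

(* [P x] is the law of the walk started at [x], given through its
   finite-dimensional distributions; the type of lattice points carries no
   sigma-algebra in the library, hence the first field. *)
Record simple_random_walk (R : realType) (d : nat) (dW : measure_display)
    (W : measurableType dW) (P : 'rV[int]_d -> probability W R)
    (S : nat -> W -> 'rV[int]_d) : Prop := SimpleRandomWalk {
  srw_measurable : forall k z, measurable [set w | S k w = z] ;
  srw_law : forall (x : 'rV[int]_d) (n : nat) (z : nat -> 'rV[int]_d),
    P x [set w | forall k, (k <= n)%N -> S k w = z k] =
    ((z 0%N == x)%:R * \prod_(k < n) srw_step R (z k) (z k.+1))%:E }.

(* [None] encodes an infinite hitting time. *)
Definition hitting_time (d : nat) (W : Type) (S : nat -> W -> 'rV[int]_d)
    (y : 'rV[int]_d) (w : W) : option nat :=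
  match pselect (exists k, S k w == y) with
  | left ex_hit => Some (ex_minn ex_hit)
  | right _ => None
  end.

Definition travel_weight (R : realType) (d : nat) (W : Type)
    (S : nat -> W -> 'rV[int]_d) (y : 'rV[int]_d) (omega : 'rV[int]_d -> R)
    (w : W) : R :=
  if hitting_time S y w is Some h
  then expR (- \sum_(0 <= k < h) omega (S k w)) else 0.

(* e(x, y, omega) *)
Definition travel_e (R : realType) (d : nat) (dW : measure_display)
    (W : measurableType dW) (P : 'rV[int]_d -> probability W R)
    (S : nat -> W -> 'rV[int]_d) (x y : 'rV[int]_d)
    (omega : 'rV[int]_d -> R) : \bar R :=
  'E_(P x)[travel_weight S y omega].

(* a(x, y, omega) *)
Definition travel_cost (R : realType) (d : nat) (dW : measure_display)
    (W : measurableType dW) (P : 'rV[int]_d -> probability W R)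
    (S : nat -> W -> 'rV[int]_d) (x y : 'rV[int]_d)
    (omega : 'rV[int]_d -> R) : \bar R :=
  (- lne (travel_e P S x y omega))%E.

Definition independent_family (R : realType) (d : nat) (dO : measure_display)
    (Omega : measurableType dO) (Q : probability Omega R)
    (omega : 'rV[int]_d -> {mfun Omega >-> R}) : Prop :=
  forall (s : seq 'rV[int]_d) (B : 'rV[int]_d -> set R),
    uniq s -> (forall z, measurable (B z)) ->
    Q (\bigcap_(z in [set` s]) (omega z @^-1` B z)) =
    (\prod_(z <- s) Q (omega z @^-1` B z))%E.

Record bernoulli_potential (R : realType) (d : nat) (dO : measure_display)
    (Omega : measurableType dO) (Q : probability Omega R)
    (omega : 'rV[int]_d -> {mfun Omega >-> R}) (r : R) : Prop :=
  BernoulliPotential {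
  bernoulli_potential_independent : independent_family Q omega ;
  bernoulli_potential0 : forall z, Q [set o | omega z o = 0] = r%:E ;
  bernoulli_potential1 : forall z, Q [set o | omega z o = 1] = (1 - r)%:E }.

(* E[a(0, n x, omega)] / n; the value at n = 0 is irrelevant. *)
Definition mean_travel_cost (R : realType) (d : nat)
    (dW : measure_display) (W : measurableType dW)
    (P : 'rV[int]_d -> probability W R) (S : nat -> W -> 'rV[int]_d)
    (dO : measure_display) (Omega : measurableType dO)
    (Q : probability Omega R) (omega : 'rV[int]_d -> {mfun Omega >-> R})
    (x : 'rV[int]_d) (n : nat) : \bar R :=
  ((n%:R^-1)%:E * \int[Q]_o travel_cost P S 0 (x *+ n) (omega ^~ o))%E.

Record quenched_lyapunov_exponent (R : realType) (d : nat)
    (dW : measure_display) (W : measurableType dW)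
    (P : 'rV[int]_d -> probability W R) (S : nat -> W -> 'rV[int]_d)
    (dO : measure_display) (Omega : measurableType dO)
    (Q : probability Omega R) (omega : 'rV[int]_d -> {mfun Omega >-> R})
    (alpha : 'rV[R]_d -> R) : Prop := QuenchedLyapunovExponent {
  lyapunov_norm : is_norm alpha ;
  lyapunov_lim : forall x : 'rV[int]_d,
    mean_travel_cost P S Q omega x n @[n --> \oo]
      --> (alpha (map_mx intr x))%:E ;
  lyapunov_inf : forall x : 'rV[int]_d,
    ereal_inf [set mean_travel_cost P S Q omega x n | n in [set n | (0 < n)%N]]
      = (alpha (map_mx intr x))%:E }.

(* Main.v *)
(* Let e_N be the partition function restricted to walks of at most N steps: a
   finite sum over lattice paths, whose logarithm is a local function of the
   potential.  Write a_N = - log e_N.  By Russo's formula the derivative of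
   E_r[a_N(0, y)] in r is - sum_z E_r[Delta_z], where Delta_z is the increase of
   a_N when the site z is switched from 0 to 1.  If D_z is the probability, under
   the weighted path measure, that the path visits z, then
   Delta_z >= (1 - 1/e) D_z, and sum_z D_z, the mean number of visited sites, is
   at least |y|_1; this is (1).

   For (2), let R_z be the distance from z to the first obstacle in a fixed
   coordinate direction.  The walk leaves z for good with probability at least
   (1 - 1/e) (2d)^(-R_z), hence Delta_z <= C (2d)^(R_z) D_z, and also
   Delta_z <= C R_z D_z' with D_z' the visiting probability when z is empty.  The
   first bound is used for small r, the second, with E_r[D_z'] <= E_r[D_z] / r,
   for the other r.  Jensen's inequality for the logarithm gives
   E_r[sum_z D_z] <= C |y|_1, since every visited site carries an independent
   factor e^(-omega).  There remains a greedy lattice animal estimate: if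
   a^(4(d+1)) r <= 1, then E_r[sum_z D_z a^(R_z)] <= C (1 + E_r[sum_z D_z]).
   Sites with R_z > m are counted by following the path at a scale M of order
   a^(4m), large enough for the entropy of the coarse path, log M per M visited
   sites, to be negligible. *)

Require Import Defs.
From HB Require Import structures.
From mathcomp Require Import all_boot all_order all_algebra.
From mathcomp Require Import all_classical all_reals all_analysis.
From mathcomp Require Import measurable_realfun zify ring lra.

Set Implicit Arguments.
Unset Strict Implicit.
Unset Printing Implicit Defensive.

Import Order.TTheory GRing.Theory Num.Theory.
Import numFieldNormedType.Exports.

Local Open Scope classical_set_scope.
Local Open Scope ring_scope.

(** * Lattice paths *)

(** Neither bound on Delta_z covers all r. The first is exponential in the rod length, so its mean
    is under control only when (2d)^(4(d+1)) r <= 1. The second keeps only the logarithm of that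
    exponential, hence lies below C a^(R_z) for any a > 1, and a can be taken as close to 1 as q_0
    demands; but it refers to an emptied site, and the resulting 1/r would ruin a constant uniform
    down to p = 0. The escape estimate cannot rest on transience, which fails for d <= 2. Weight
    lost at an obstacle counts as not returning, and the finite horizon N plays the same role when
    the rod meets no obstacle. Russo's formula enters through the mean value theorem: all bounds are
    uniform over the parameters in question, so a single intermediate parameter suffices. They are
    also uniform in N, which is sent to infinity before the endpoint. *)

Definition upd (T : eqType) (V : Type) (f : T -> V) (z : T) (v : V) : T -> V :=
  fun x => if x == z then v else f x.

Lemma upd_id (T : eqType) (V : Type) (f : T -> V) z : upd f z (f z) = f.
Proof. by apply/funext => x; rewrite /upd; case: eqP => [->|]. Qed.

Definition unit_steps (d : nat) : seq 'rV[int]_d :=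
  [seq delta_mx 0 i | i <- enum 'I_d] ++ [seq - delta_mx 0 i | i <- enum 'I_d].

Definition nbrs (d : nat) (x : 'rV[int]_d) : seq 'rV[int]_d :=
  [seq x + e | e <- unit_steps d].

Definition adj (d : nat) : rel 'rV[int]_d := fun u v => v \in nbrs u.

Definition l1 (d : nat) (x : 'rV[int]_d) : nat := (\sum_(i < d) `|x 0%R i|)%N.

Lemma l1normE (d : nat) (x : 'rV[int]_d) : l1norm x = (l1 x)%:Z.
Proof.
rewrite /l1norm /l1 (raddf_sum Posz); exact: eq_bigr.
Qed.

Lemma l1N (d : nat) (x : 'rV[int]_d) : l1 (- x) = l1 x.
Proof. by apply: eq_bigr => i _; rewrite mxE abszN. Qed.

Lemma l1D (d : nat) (x y : 'rV[int]_d) : (l1 (x + y) <= l1 x + l1 y)%N.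
Proof.
rewrite /l1 -big_split /=; apply: leq_sum => i _; rewrite mxE.
by move: (x 0 i) (y 0 i) => a b; lia.
Qed.

Lemma l1Mn (d n : nat) (z : 'rV[int]_d) : l1 (z *+ n) = (n * l1 z)%N.
Proof.
rewrite -scaler_nat /l1 big_distrr /=; apply: eq_bigr => i _.
by rewrite mxE abszM natz.
Qed.

Lemma l1B (d : nat) (x y : 'rV[int]_d) : l1 (x - y) = l1 (y - x).
Proof. by rewrite -l1N opprB. Qed.

Lemma l1_eq0 (d : nat) (x : 'rV[int]_d) : (l1 x == 0%N) = (x == 0).
Proof.
rewrite /l1 sum_nat_eq0; apply/forallP/eqP => [H|-> i]; last by rewrite mxE.
by apply/rowP => i; have := H i; rewrite mxE /= => /eqP; lia.
Qed.

Lemma l1_delta (d : nat) (i : 'I_d) : l1 (delta_mx 0 i : 'rV[int]_d) = 1%N.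
Proof.
rewrite /l1 (bigD1 i) //= mxE !eqxx /= big1 ?addn0 // => j ji.
by rewrite mxE (negPf ji) andbF.
Qed.

Lemma size_unit_steps (d : nat) : size (unit_steps d) = (2 * d)%N.
Proof. by rewrite size_cat size_map [X in (_ + X)%N]size_map size_enum_ord mul2n addnn. Qed.

Lemma size_nbrs (d : nat) (x : 'rV[int]_d) : size (nbrs x) = (2 * d)%N.
Proof. by rewrite size_map size_unit_steps. Qed.

Lemma delta_mx_row_inj (d : nat) :
  injective (fun i : 'I_d => delta_mx 0 i : 'rV[int]_d).
Proof.
move=> i j /rowP /(_ i); rewrite !mxE !eqxx /=.
by case: eqP.
Qed.

Lemma uniq_unit_steps (d : nat) : uniq (unit_steps d).
Proof.
rewrite cat_uniq map_inj_uniq; last exact: delta_mx_row_inj.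
rewrite [X in [&& _, _ & X]]map_inj_uniq; last first.
  by move=> i j /(@oppr_inj 'rV[int]_d) /delta_mx_row_inj.
rewrite enum_uniq andbT /=.
apply/hasPn => _ /mapP[i _ ->]; apply/negP => /mapP[j _] /rowP /(_ j).
by rewrite !mxE !eqxx /=; case: eqP.
Qed.

Lemma uniq_nbrs (d : nat) (x : 'rV[int]_d) : uniq (nbrs x).
Proof. by rewrite map_inj_uniq ?uniq_unit_steps //; exact: addrI. Qed.

Lemma mem_unit_steps (d : nat) (e : 'rV[int]_d) :
  (e \in unit_steps d) = (l1 e == 1%N).
Proof.
apply/idP/eqP.
  by rewrite mem_cat => /orP[] /mapP[i _ ->]; rewrite ?l1N l1_delta.
move=> e1; have [i ei] : exists i, e 0 i != 0.
  apply/existsP; rewrite -negb_forall; apply/negP => /forallP e0.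
  by move: e1; rewrite /l1 big1 // => i _; move/eqP: (e0 i) => ->.
have ej j : j != i -> e 0 j = 0.
  move=> ji; move: e1; rewrite /l1 (bigD1 i) //= (bigD1 j) //=.
  by lia.
have ei1 : absz (e 0 i) = 1%N.
  by move: e1; rewrite /l1 (bigD1 i) //= big1 ?addn0 // => j /ej ->.
have [e_i|e_i] : e 0 i = 1 \/ e 0 i = -1 by lia.
- rewrite mem_cat; apply/orP; left; apply/mapP; exists i; rewrite ?mem_enum //.
  apply/rowP => j; rewrite mxE eqxx /=; have [->|/ej ->//] := eqVneq j i.
  by rewrite e_i.
- rewrite mem_cat; apply/orP; right; apply/mapP; exists i; rewrite ?mem_enum //.
  apply/rowP => j; rewrite !mxE eqxx /=; have [->|/ej ->//] := eqVneq j i.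
  by rewrite e_i.
Qed.

Lemma mem_nbrs (d : nat) (x v : 'rV[int]_d) : (v \in nbrs x) = (l1 (v - x) == 1%N).
Proof.
rewrite -mem_unit_steps -[in LHS](subrKC x v) (mem_map (addrI x)) //.
Qed.

Lemma l1_nbrs (d : nat) (x v y : 'rV[int]_d) : v \in nbrs x ->
  (l1 (v - y) <= l1 (x - y) + 1)%N /\ (l1 (x - y) <= l1 (v - y) + 1)%N.
Proof.
rewrite mem_nbrs => /eqP vx.
have := l1D (v - x) (x - y); have := l1D (x - v) (v - y).
by rewrite l1B vx !subrKA addnC [in X in _ -> X]addnC => ? ?; split.
Qed.

Lemma closer_nbr (d : nat) (x y : 'rV[int]_d) : x != y ->
  exists2 v, v \in nbrs x & l1 (x - y) = (l1 (v - y)).+1.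
Proof.
rewrite -subr_eq0 => /eqP xy.
have [i xi] : exists i, (x - y) 0 i != 0.
  apply/existsP; rewrite -negb_forall; apply/negP => /forallP e0.
  by apply: xy; apply/rowP => i; rewrite (eqP (e0 i)) mxE.
pose e : 'rV[int]_d := if 0 < (x - y) 0 i then - delta_mx 0 i else delta_mx 0 i.
have e1 : l1 e = 1%N by rewrite /e; case: ifP; rewrite ?l1N l1_delta.
exists (x + e); first by rewrite mem_nbrs addrAC subrr add0r e1.
rewrite /l1 (bigD1 i) //= [in RHS](bigD1 i) //= -addSn; congr addn.
  move: xi; rewrite /e !mxE; case: ifPn; rewrite !mxE !eqxx /=; lia.
apply: eq_bigr => j ji; rewrite /e !mxE; case: ifP; rewrite !mxE (negPf ji) ?andbF /=; lia.
Qed.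

(* A path is the list of the sites visited before the first hit of [y], in at most
   [n] steps. *)
Fixpoint paths (d n : nat) (y x : 'rV[int]_d) : seq (seq 'rV[int]_d) :=
  if x == y then [:: [::]]
  else if n is n'.+1
  then [seq x :: p | p <- flatten [seq paths n' y v | v <- nbrs x]]
  else [::].

Lemma mem_paths (d n : nat) (y x : 'rV[int]_d) (p : seq 'rV[int]_d) :
  p \in paths n y x ->
  [/\ (size p <= n)%N, y \notin p &
      exists q, rcons p y = x :: q /\ path (@adj d) x q].
Proof.
elim: n x p => [|n IHn] x p /=.
  case: eqP => // ->; rewrite inE => /eqP ->; split => //.
  by exists [::].
case: eqP => [->|/eqP xy].
  by rewrite inE => /eqP ->; split => //; exists [::].
move=> /mapP[p' /flattenP[_ /mapP[v vx ->]] /IHn[sp yp [q [pq aq]]] ->] /=.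
split => //; first by rewrite inE negb_or eq_sym xy.
by exists (v :: q); rewrite pq /= aq /adj vx.
Qed.

Lemma chain_lt (d : nat) (f : 'rV[int]_d -> nat) (k : nat) (x : 'rV[int]_d) q :
  (forall u v, v \in nbrs u -> (f v <= f u + 1)%N) ->
  path (@adj d) x q -> (forall z, z \in x :: q -> f z <> k) -> (f x < k)%N ->
  forall z, z \in x :: q -> (f z < k)%N.
Proof.
move=> f1; elim: q x => [|v q IHq] x /=.
  by move=> _ _ fx z; rewrite inE => /eqP ->.
move=> /andP[xv aq] fk fx z; rewrite inE => /predU1P[-> //|zq].
apply: (IHq v) => //; first by move=> z' z'q; apply: fk; rewrite inE z'q orbT.
have := fk v; rewrite !inE eqxx orbT => /(_ isT); have := f1 _ _ xv; lia.
Qed.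

Lemma chain_gt (d : nat) (f : 'rV[int]_d -> nat) (k : nat) (x : 'rV[int]_d) q :
  (forall u v, v \in nbrs u -> (f u <= f v + 1)%N) ->
  path (@adj d) x q -> (forall z, z \in x :: q -> f z <> k) -> (k < f x)%N ->
  forall z, z \in x :: q -> (k < f z)%N.
Proof.
move=> f1; elim: q x => [|v q IHq] x /=.
  by move=> _ _ fx z; rewrite inE => /eqP ->.
move=> /andP[xv aq] fk fx z; rewrite inE => /predU1P[-> //|zq].
apply: (IHq v) => //; first by move=> z' z'q; apply: fk; rewrite inE z'q orbT.
have := fk v; rewrite !inE eqxx orbT => /(_ isT); have := f1 _ _ xv; lia.
Qed.

(** Discrete intermediate value theorem: the distance to [c] changes by at most one per step. As [a]
    and [b] come in no prescribed order, it is the head of the chain that is compared with [k]. *)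
Lemma chain_ivt (d : nat) (c x : 'rV[int]_d) q a b k :
  path (@adj d) x q -> a \in x :: q -> b \in x :: q ->
  (l1 (a - c) <= k)%N -> (k <= l1 (b - c))%N ->
  exists2 z, z \in x :: q & l1 (z - c) = k.
Proof.
move=> aq ain bin ka kb.
case: (boolP (has (fun z => l1 (z - c) == k) (x :: q))) => [/hasP[z zq /eqP]|].
  by exists z.
move=> /hasPn nk.
have nk' z : z \in x :: q -> l1 (z - c) <> k by move=> /nk /eqP.
have [fx|fx] := ltnP (l1 (x - c)) k.
- have f1 u v : v \in nbrs u -> (l1 (v - c) <= l1 (u - c) + 1)%N.
    by move=> /(l1_nbrs c) [].
  by have := chain_lt f1 aq nk' fx bin; rewrite ltnNge kb.
- have {}fx : (k < l1 (x - c))%N.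
    by rewrite ltn_neqAle fx andbT eq_sym; apply/eqP/nk'; rewrite inE eqxx.
  have f1 u v : v \in nbrs u -> (l1 (u - c) <= l1 (v - c) + 1)%N.
    by move=> /(l1_nbrs c) [].
  by have := chain_gt f1 aq nk' fx ain; rewrite ltnNge ka.
Qed.

(** The path takes every distance [1, ..., l1 (x - y)] from [y], at distinct sites. Distance 0 is
    left out because [y] is not listed in [p]. *)
Lemma l1_le_range (d n : nat) (y x : 'rV[int]_d) (p : seq 'rV[int]_d) :
  p \in paths n y x -> (l1 (x - y) <= size (undup p))%N.
Proof.
move=> /mem_paths[_ yp [q [pq aq]]].
have -> : l1 (x - y) = size (iota 1 (l1 (x - y))) by rewrite size_iota.
rewrite -(size_map (fun z => l1 (z - y)) (undup p)); apply: uniq_leq_size.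
  exact: iota_uniq.
move=> k; rewrite mem_iota => /andP[k1 k2].
have [||||z zp zk] := @chain_ivt d y x q y x k aq.
- by rewrite -pq mem_rcons inE eqxx.
- by rewrite inE eqxx.
- by rewrite subrr; have /eqP-> : l1 (0 : 'rV[int]_d) == 0%N by rewrite l1_eq0.
- by rewrite -ltnS.
apply/mapP; exists z => //; rewrite mem_undup.
move: zp; rewrite -pq mem_rcons inE => /predU1P[zy|//].
move: zk; rewrite zy subrr; have /eqP-> : l1 (0 : 'rV[int]_d) == 0%N by rewrite l1_eq0.
by lia.
Qed.

(** * Path sums *)

Section PathSums.
Variables (R : realType) (d : nat).
Implicit Types (x y z v : 'rV[int]_d) (w : 'rV[int]_d -> R) (n : nat).

Definition avg (f : 'rV[int]_d -> R) x : R :=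
  (2 * d)%:R^-1 * \sum_(v <- nbrs x) f v.

Definition pweight w (p : seq 'rV[int]_d) : R :=
  \prod_(z <- p) (w z * (2 * d)%:R^-1).

Definition psum n y w x : R := \sum_(p <- paths n y x) pweight w p.

Lemma psum0 y w x : psum 0 y w x = (x == y)%:R.
Proof.
by rewrite /psum /=; case: eqP => _; rewrite ?big_seq1 ?big_nil // /pweight big_nil.
Qed.

Lemma psumS n y w x :
  psum n.+1 y w x = if x == y then 1 else w x * avg (psum n y w) x.
Proof.
rewrite /psum /=; case: eqP => _; first by rewrite big_seq1 /pweight big_nil.
rewrite big_map big_flatten /= big_map /avg !mulr_sumr.
apply: eq_bigr => v _; rewrite !mulr_sumr.
by apply: eq_bigr => p _; rewrite /pweight big_cons mulrA.
Qed.

Lemma psumxx n y w : psum n y w y = 1.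
Proof. by case: n => [|n]; rewrite ?psum0 ?psumS eqxx. Qed.

Lemma avg_le (f g : 'rV[int]_d -> R) x :
  (forall v, v \in nbrs x -> f v <= g v) -> avg f x <= avg g x.
Proof.
move=> fg; apply: ler_wpM2l; first by rewrite invr_ge0.
by rewrite big_seq [leRHS]big_seq; apply: ler_sum.
Qed.

Lemma avg_ge0 (f : 'rV[int]_d -> R) x : (forall v, 0 <= f v) -> 0 <= avg f x.
Proof. by move=> f0; apply: mulr_ge0; rewrite ?invr_ge0 ?sumr_ge0. Qed.

Lemma avgD (f g : 'rV[int]_d -> R) x :
  avg (fun v => f v + g v) x = avg f x + avg g x.
Proof. by rewrite /avg big_split /= mulrDr. Qed.

Lemma avgZ (c : R) (f : 'rV[int]_d -> R) x :
  avg (fun v => c * f v) x = c * avg f x.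
Proof. by rewrite /avg -mulr_sumr mulrCA. Qed.

Lemma avgB (f g : 'rV[int]_d -> R) x :
  avg (fun v => f v - g v) x = avg f x - avg g x.
Proof. by rewrite /avg sumrB mulrBr. Qed.

Lemma avg_cst (c : R) x : (0 < d)%N -> avg (fun=> c) x = c.
Proof.
move=> d0; rewrite /avg big_const_seq count_predT size_nbrs iter_addr_0.
by rewrite -[X in _ * X]mulr_natl mulrA mulVf ?mul1r // pnatr_eq0 muln_eq0 -lt0n.
Qed.

Lemma avg_nbr (f : 'rV[int]_d -> R) x v : (forall u, 0 <= f u) ->
  v \in nbrs x -> (2 * d)%:R^-1 * f v <= avg f x.
Proof.
move=> f0 vx; apply: ler_wpM2l; first by rewrite invr_ge0.
by rewrite (big_rem v) //= lerDl sumr_ge0.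
Qed.

Lemma pweight_ge0 w p : (forall x, 0 <= w x) -> 0 <= pweight w p.
Proof. by move=> w0; apply: prodr_ge0 => z _; rewrite mulr_ge0 ?invr_ge0. Qed.

Lemma psum_ge0 n y w x : (forall x, 0 <= w x) -> 0 <= psum n y w x.
Proof. by move=> w0; apply: sumr_ge0 => p _; exact: pweight_ge0. Qed.

Lemma psum_le n y w w' x : (forall x, 0 <= w x) -> (forall x, w x <= w' x) ->
  psum n y w x <= psum n y w' x.
Proof.
move=> w0 ww'; rewrite /psum; apply: ler_sum => p _.
apply: ler_prod => z _; rewrite mulr_ge0 ?invr_ge0 //=.
by apply: ler_wpM2r; rewrite ?invr_ge0.
Qed.

Lemma psum_leS n y w x : (forall x, 0 <= w x) -> psum n y w x <= psum n.+1 y w x.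
Proof.
move=> w0; elim: n x => [|n IHn] x.
  rewrite psum0 psumS; case: eqP => //= _.
  by rewrite mulr_ge0 // avg_ge0 // => v; exact: psum_ge0.
rewrite psumS [leRHS]psumS; case: eqP => // _.
by apply: ler_wpM2l => //; apply: avg_le => v _; exact: IHn.
Qed.

Lemma psum_le1 n y w x : (0 < d)%N -> (forall x, 0 <= w x) ->
  (forall x, w x <= 1) -> psum n y w x <= 1.
Proof.
move=> d0 w0 w1; elim: n x => [|n IHn] x.
  by rewrite psum0; case: eqP.
rewrite psumS; case: eqP => // _; rewrite -[leRHS]mulr1; apply: ler_pM => //.
  by rewrite avg_ge0 // => v; exact: psum_ge0.
by rewrite -[leRHS](avg_cst 1 x) //; exact: avg_le.
Qed.

Lemma psum_avoid n y z w x :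
  psum n y (upd w z 0) x = \sum_(p <- paths n y x | z \notin p) pweight w p.
Proof.
rewrite /psum [RHS]big_mkcond /=; apply: eq_bigr => p _; rewrite /pweight.
case: ifPn => [zp|/negPn zp].
  apply: eq_big_seq => v vp; rewrite /upd; case: eqP => // vz.
  by rewrite -vz vp in zp.
by rewrite (big_rem z) //= /upd eqxx !mul0r.
Qed.

Lemma psum_visit n y z w x :
  psum n y w x - psum n y (upd w z 0) x =
  \sum_(p <- paths n y x | z \in p) pweight w p.
Proof.
rewrite psum_avoid /psum (bigID (fun p : seq 'rV[int]_d => z \in p)) /=.
by rewrite addrK.
Qed.

Lemma sum_visit n y w x (s : seq 'rV[int]_d) (f : 'rV[int]_d -> R) :
  uniq s -> (forall p, p \in paths n y x -> {subset p <= s}) ->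
  \sum_(z <- s) (psum n y w x - psum n y (upd w z 0) x) * f z =
  \sum_(p <- paths n y x) pweight w p * \sum_(z <- undup p) f z.
Proof.
move=> us ps.
under eq_bigr do rewrite psum_visit mulr_suml big_mkcond.
rewrite exchange_big /= big_seq [RHS]big_seq; apply: eq_bigr => p /ps psub.
rewrite -big_mkcond /= -mulr_sumr; congr (_ * _).
have sp : perm_eq [seq z <- s | z \in p] (undup p).
  apply: uniq_perm; [exact: filter_uniq|exact: undup_uniq|move=> z].
  by rewrite mem_filter mem_undup; case: (boolP (z \in p)) => //= /psub.
by rewrite -[LHS]big_filter (perm_big _ sp).
Qed.

Lemma updxx w z t : upd w z t z = t.
Proof. by rewrite /upd eqxx. Qed.

Lemma updNx w z t x : x != z -> upd w z t x = w x.
Proof. by rewrite /upd => /negPf ->. Qed.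

Lemma upd_ge0 w z t : (forall x, 0 <= w x) -> 0 <= t -> forall x, 0 <= upd w z t x.
Proof. by move=> w0 t0 x; rewrite /upd; case: eqP. Qed.

Lemma upd_le1 w z t : (forall x, w x <= 1) -> t <= 1 -> forall x, upd w z t x <= 1.
Proof. by move=> w0 t0 x; rewrite /upd; case: eqP. Qed.

Lemma upd_le w z t t' x : t <= t' -> upd w z t x <= upd w z t' x.
Proof. by rewrite /upd; case: eqP. Qed.

(** A path through [z] carries one factor [t] per visit, hence at most a single [t] in all. The
    induction spends this factor at the first visit and then replaces [t] by 1. *)
Lemma psum_upd_le n y w z (t : R) x : z != y -> (forall x, 0 <= w x) ->
  0 <= t <= 1 ->
  psum n y (upd w z t) x <=
  psum n y (upd w z 0) x +
  t * (psum n y (upd w z 1) x - psum n y (upd w z 0) x).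
Proof.
move=> zy w0 /andP[t0 t1]; elim: n x => [|n IHn] x.
  by rewrite !psum0 subrr mulr0 addr0.
rewrite !psumS; case: eqP => [_|xy]; first by rewrite subrr mulr0 addr0.
have [->|xz] := eqVneq x z.
  rewrite !updxx mul0r add0r subr0 mul1r; apply: ler_wpM2l => //.
  by apply: avg_le => v _; apply: psum_le => u; [exact: upd_ge0|exact: upd_le].
rewrite !updNx // -mulrBr [X in _ + X]mulrCA -mulrDr; apply: ler_wpM2l => //.
apply: le_trans (avg_le (fun v _ => IHn v)) _.
by rewrite avgD avgZ avgB.
Qed.

(** Split at the first visit to [z]: before it the walk avoids [y], after it the walk restarts from
    [z]. Both pieces are granted all [n] steps, which gives an inequality. *)
Lemma psum_passage n y z w x : z != y -> (forall x, 0 <= w x) ->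
  psum n y w x <=
  psum n y (upd w z 0) x + psum n z (upd w y 0) x * psum n y w z.
Proof.
move=> zy w0; elim: n x => [|n IHn] x.
  rewrite !psum0 lerDl; exact: mulr_ge0.
have [->|xz] := eqVneq x z.
  by rewrite psumxx mul1r lerDr psum_ge0 //; exact: upd_ge0.
have [->|xy] := eqVneq x y.
  by rewrite !psumxx lerDl mulr_ge0 ?psum_ge0 //; exact: upd_ge0.
rewrite psumS [psum n.+1 y (upd _ _ _) _]psumS [psum _ z _ _]psumS.
rewrite (negPf xy) (negPf xz) !updNx //.
apply: (@le_trans _ _ (w x * avg (fun v => psum n y (upd w z 0) v +
   psum n y w z * psum n z (upd w y 0) v) x)).
  by apply: ler_wpM2l => //; apply: avg_le => v _; rewrite [X in _ + X]mulrC; exact: IHn.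
rewrite avgD avgZ mulrDr lerD2l [X in _ * X]mulrC mulrA; apply: ler_wpM2l.
  by apply: mulr_ge0 => //; apply: avg_ge0 => v; apply: psum_ge0; exact: upd_ge0.
exact: psum_leS.
Qed.

(* [1 - kap] bounds the weight of the loops at [z], so a walk at [z] is at its last
   visit there with probability at least [kap]. *)
Lemma psum_return n y z w kap : z != y -> (forall x, 0 <= w x) ->
  w z = 1 -> avg (psum n z (upd w y 0)) z <= 1 - kap ->
  kap * avg (psum n y w) z <= avg (psum n y (upd w z 0)) z.
Proof.
move=> zy w0 wz rho.
have uz : psum n.+1 y w z = avg (psum n y w) z by rewrite psumS (negPf zy) wz mul1r.
have a0 : 0 <= avg (psum n y w) z by apply: avg_ge0 => v; exact: psum_ge0.
have H : avg (psum n y w) z <= avg (psum n y (upd w z 0)) z +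
    avg (psum n z (upd w y 0)) z * avg (psum n y w) z.
  rewrite [X in _ + X]mulrC -avgZ -avgD; apply: avg_le => v _.
  apply: le_trans (psum_passage _ _ zy w0) _; rewrite lerD2l mulrC.
  apply: ler_wpM2r; first by apply: psum_ge0; exact: upd_ge0.
  by rewrite -uz psum_leS.
have : avg (psum n z (upd w y 0)) z * avg (psum n y w) z <=
   (1 - kap) * avg (psum n y w) z by exact: ler_wpM2r.
lra.
Qed.

(** Reverse of [psum_upd_le]: keep only the paths that do not come back to [z] after their first
    visit. They carry a single factor [t], and by [psum_return] they hold at least the share [kap]
    of the weight of the paths through [z]. *)
Lemma psum_upd_ge n y w z (t kap : R) x : z != y -> (forall x, 0 <= w x) ->
  0 <= t -> 0 <= kap -> t * kap <= 1 ->
  (forall k, (k < n)%N -> avg (psum k z (upd (upd w z 1) y 0)) z <= 1 - kap) ->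
  psum n y (upd w z 0) x +
  t * kap * (psum n y (upd w z 1) x - psum n y (upd w z 0) x)
  <= psum n y (upd w z t) x.
Proof.
move=> zy w0 t0 k0 tk1; elim: n x => [|n IHn] x esc.
  by rewrite !psum0 subrr mulr0 addr0.
have {}IHn x' := IHn x' (fun k kn => esc k (ltnW kn)).
rewrite !psumS; case: eqP => [_|xy]; first by rewrite subrr mulr0 addr0.
have [->|xz] := eqVneq x z.
  rewrite !updxx mul0r add0r subr0 mul1r -mulrA; apply: ler_wpM2l => //.
  apply: (@le_trans _ _ (avg (psum n y (upd w z 0)) z)).
    have -> : upd w z 0 = upd (upd w z 1) z 0.
      by apply/funext => u; rewrite /upd; case: eqP.
    apply: psum_return; rewrite ?updxx //; first exact: upd_ge0.
    exact: esc.
  by apply: avg_le => v _; apply: psum_le => u; [exact: upd_ge0|exact: upd_le].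
rewrite !updNx // -mulrBr [X in _ + X]mulrCA -mulrDr; apply: ler_wpM2l => //.
apply: le_trans (avg_le (fun v _ => IHn v)).
by rewrite avgD avgZ avgB.
Qed.

Lemma psum_ge n y w x (c : R) : 0 <= c -> (0 < d)%N ->
  (forall x, c <= w x) -> (l1 (x - y) <= n)%N ->
  (c * (2 * d)%:R^-1) ^+ l1 (x - y) <= psum n y w x.
Proof.
move=> c0 d0 cw; have w0 u : 0 <= w u by exact: le_trans (cw u).
elim: n x => [|n IHn] x.
  rewrite leqn0 => /eqP xy; rewrite xy expr0 psum0.
  by move/eqP: xy; rewrite l1_eq0 subr_eq0 => ->.
move=> xyn; rewrite psumS; case: eqP => [->|/eqP xy].
  by rewrite subrr; have /eqP -> : l1 (0 : 'rV[int]_d) == 0%N by rewrite l1_eq0.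
have [v vx e] := closer_nbr xy; rewrite e exprS -mulrA.
apply: ler_pM => //.
  by rewrite mulr_ge0 ?invr_ge0 // exprn_ge0 // mulr_ge0 ?invr_ge0.
apply: le_trans (avg_nbr _ vx); last by move=> u; exact: psum_ge0.
apply: ler_wpM2l; first by rewrite invr_ge0.
by apply: IHn; move: xyn; rewrite e ltnS.
Qed.

Lemma psum_pos n y w x : (0 < d)%N -> (forall z, 0 < w z) ->
  (l1 (x - y) <= n)%N -> 0 < psum n y w x.
Proof.
move=> d_gt0 w0; have w0' z := ltW (w0 z).
elim: n x => [|n IHn] x.
  by rewrite leqn0 l1_eq0 subr_eq0 psum0 => ->.
move=> xyn; rewrite psumS; case: eqP => [//|/eqP xy].
have [v vx e] := closer_nbr xy; apply: mulr_gt0 => //.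
apply: lt_le_trans (avg_nbr _ vx); last by move=> u; exact: psum_ge0.
rewrite mulr_gt0 ?invr_gt0 ?ltr0n ?muln_gt0 //.
by apply: IHn; move: xyn; rewrite e ltnS.
Qed.

End PathSums.

(** * Sensitivity to one site *)

Section Sensitivity.
Variables (R : realType) (d : nat) (i0 : 'I_d).
Implicit Types (x y z v : 'rV[int]_d) (sigma : 'rV[int]_d -> bool) (n : nat).

(* In a configuration [sigma], [true] marks an obstacle (potential 1). *)
Definition bweight sigma z : R := if sigma z then expR (-1) else 1.

Definition cost n y sigma x : R := - ln (psum n y (bweight sigma) x).

(* Probability of visiting [z] under the weighted path measure: a path avoids [z]
   iff it survives setting the weight of [z] to 0. *)
Definition hitprob n y sigma x z : R :=
  (psum n y (bweight sigma) x - psum n y (upd (bweight sigma) z 0) x)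
  / psum n y (bweight sigma) x.

(** The shift by one keeps [z] off its own rod, so that the rod length does not depend on the state
    of [z]. *)
Definition rod_site z j : 'rV[int]_d := z + j.+1%:Z *: delta_mx 0 i0.

(* Capped at [n + 1] when the rod meets no obstacle. *)
Definition rod_len n sigma z : nat :=
  (find (fun j => sigma (rod_site z j)) (iota 0 n)).+1.

(** Lower bound for the chance of never returning to [z]: go straight to the first obstacle, then
    lose the fraction 1 - 1/e of the weight there. *)
Definition kappa n sigma z : R :=
  (1 - expR (-1)) * (2 * d)%:R^-1 ^+ rod_len n sigma z.

Lemma expRN1_lt1 : expR (-1) < 1 :> R.
Proof. by rewrite expR_lt1 ltrN10. Qed.

Lemma bweight_upd sigma z b :
  bweight (upd sigma z b) = upd (bweight sigma) z (if b then expR (-1) else 1).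
Proof. by apply/funext => x; rewrite /bweight /upd; case: eqP. Qed.

Lemma bweight_ge0 sigma z : 0 <= bweight sigma z.
Proof. by rewrite /bweight; case: ifP; rewrite ?expR_ge0. Qed.

Lemma bweight_le1 sigma z : bweight sigma z <= 1.
Proof. by rewrite /bweight; case: ifP => // _; rewrite ltW // expRN1_lt1. Qed.

Lemma bweight_geN1 sigma z : expR (-1) <= bweight sigma z.
Proof. by rewrite /bweight; case: ifP => // _; rewrite ltW // expRN1_lt1. Qed.

Lemma dim_gt0 : (0 < d)%N.
Proof. exact: leq_ltn_trans (ltn_ord i0). Qed.

Lemma psum_gt0 n y sigma x : (l1 (x - y) <= n)%N ->
  0 < psum n y (bweight sigma) x.
Proof.
apply: psum_pos; first exact: dim_gt0.
by move=> z; apply: lt_le_trans (bweight_geN1 sigma z); exact: expR_gt0.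
Qed.

Lemma cost_le n y sigma x : (l1 (x - y) <= n)%N ->
  cost n y sigma x <= (l1 (x - y))%:R * (1 + ln (2 * d)%:R).
Proof.
move=> xyn; have d2 : 0 < (2 * d)%:R :> R by rewrite ltr0n muln_gt0 dim_gt0.
rewrite /cost lerNl -[leLHS]expRK ler_ln ?posrE ?expR_gt0 //; last exact: psum_gt0.
apply: le_trans (@psum_ge _ _ n y _ x (expR (-1)) _ dim_gt0 _ xyn).
- have -> : expR (-1) / (2 * d)%:R = expR (- (1 + ln (2 * d)%:R)) :> R.
    by rewrite opprD expRD [expR (- ln _)]expRN lnK.
  by rewrite -mulrN expRM_natl.
- exact: expR_ge0.
- exact: bweight_geN1.
Qed.

Lemma cost_ge0 n y sigma x : 0 <= cost n y sigma x.
Proof.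
rewrite /cost oppr_ge0 -ln1.
(* When [n] is below the distance the path sum vanishes, and [ln] takes the value 0 there. *)
have [H|H] := ltP 0 (psum n y (bweight sigma) x); last by rewrite ln1 ln0.
rewrite ler_ln ?posrE //; apply: psum_le1; first exact: dim_gt0.
  exact: bweight_ge0.
exact: bweight_le1.
Qed.

Lemma rod_site_neq z j : rod_site z j != z.
Proof.
by apply/eqP => /rowP /(_ i0); rewrite !mxE !eqxx /=; move: (z 0 i0) => a; lia.
Qed.

Lemma rod_siteS z j : rod_site z j.+1 \in nbrs (rod_site z j).
Proof.
rewrite mem_nbrs /rod_site -[j.+2]addn1 PoszD scalerDl scale1r addrA.
by rewrite [X in l1 X]addrC addKr l1_delta.
Qed.

Lemma rod_site0 z : rod_site z 0 \in nbrs z.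
Proof. by rewrite mem_nbrs /rod_site scale1r [X in l1 X]addrC addKr l1_delta. Qed.

Lemma avg_le_nbr (f : 'rV[int]_d -> R) x v (c : R) :
  (forall u, f u <= 1) -> v \in nbrs x -> f v <= 1 - c ->
  avg f x <= 1 - (2 * d)%:R^-1 * c.
Proof.
move=> f1 vx fc.
have : (2 * d)%:R^-1 * (1 - f v) <= avg (fun u => 1 - f u) x.
  by apply: (@avg_nbr _ _ (fun u => 1 - f u)) => // u; rewrite subr_ge0.
rewrite avgB avg_cst ?dim_gt0 //.
have : (2 * d)%:R^-1 * c <= (2 * d)%:R^-1 * (1 - f v).
  by apply: ler_wpM2l; rewrite ?invr_ge0 // lerBrDl -lerBrDr.
lra.
Qed.

(** Induction on the number [m] of sites left before the first obstacle; each straight step has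
    probability 1/(2d). The condition [n + j <= N] deals with the cap: if the first [N] rod sites
    are empty, then [m = 0] means [j = N], and no step is left to return to [z]. *)
Lemma rod_escape N y z sigma m n j :
  (j + m)%N = (rod_len N sigma z).-1 -> (n + j <= N)%N ->
  psum n z (upd (upd (bweight sigma) z 1) y 0) (rod_site z j)
  <= 1 - (1 - expR (-1)) * (2 * d)%:R^-1 ^+ m.
Proof.
set w := upd _ y 0.
have w0 u : 0 <= w u by apply: upd_ge0 => // v; apply: upd_ge0 => // v'; exact: bweight_ge0.
have w1 u : w u <= 1 by apply: upd_le1 => // v; apply: upd_le1 => // v'; exact: bweight_le1.
have q1 : (2 * d)%:R^-1 <= 1 :> R.
  by rewrite invf_le1 ?ler1n ?ltr0n muln_gt0 dim_gt0.
have e1 := expRN1_lt1; have e0 := expR_ge0 (-1 : R).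
elim: m n j => [|m IHm] n j jm nj.
  rewrite expr0 mulr1 opprB addrC subrK.
  case: n nj => [|n] nj; first by rewrite psum0 (negPf (rod_site_neq _ _)).
  rewrite psumS (negPf (rod_site_neq _ _)).
  apply: (@le_trans _ _ (expR (-1) * 1)); last by rewrite mulr1.
  apply: ler_pM => //; first by apply: avg_ge0 => v; exact: psum_ge0.
    rewrite /w /upd; case: eqP => // _; rewrite (negPf (rod_site_neq _ _)) /bweight.
    have -> // : sigma (rod_site z j).
    move: jm; rewrite addn0 /rod_len /= => jE.
    have hs : has (fun j => sigma (rod_site z j)) (iota 0 N).
      rewrite has_find -jE size_iota; move: nj; rewrite addSn; apply: leq_trans.
      by rewrite ltnS leq_addl.
    have := nth_find 0%N hs; rewrite -jE nth_iota ?add0n //.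
    by move: nj; rewrite addSn; apply: leq_trans; rewrite ltnS leq_addl.
  rewrite -[leRHS](@avg_cst R d 1 (rod_site z j)) ?dim_gt0 //; apply: avg_le => v _.
  by apply: psum_le1 => //; exact: dim_gt0.
case: n nj => [|n] nj.
  rewrite psum0 (negPf (rod_site_neq _ _)) subr_ge0.
  have := @exprn_ile1 R m.+1 _ _ q1; rewrite invr_ge0 ler0n => /(_ isT) qm.
  by rewrite -[leRHS]mulr1; apply: ler_pM => //; rewrite ?exprn_ge0 ?invr_ge0 //; lra.
rewrite psumS (negPf (rod_site_neq _ _)).
apply: (@le_trans _ _ (1 * avg (psum n z w) (rod_site z j))).
  by apply: ler_wpM2r => //; apply: avg_ge0 => v; exact: psum_ge0.
rewrite mul1r exprS mulrCA; apply: (avg_le_nbr _ (rod_siteS z j)).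
  by move=> u; apply: psum_le1 => //; exact: dim_gt0.
by apply: IHm; [rewrite addSnnS | rewrite addnS -addSn].
Qed.

Lemma rod_avg_escape N y z sigma n : (n <= N)%N ->
  avg (psum n z (upd (upd (bweight sigma) z 1) y 0)) z <= 1 - kappa N sigma z.
Proof.
move=> nN; rewrite /kappa /rod_len exprS mulrCA; apply: (avg_le_nbr _ (rod_site0 z)).
  move=> u; apply: psum_le1; first exact: dim_gt0.
    by apply: upd_ge0 => // v; apply: upd_ge0 => // v'; exact: bweight_ge0.
  by apply: upd_le1 => // v; apply: upd_le1 => // v'; exact: bweight_le1.
by apply: (@rod_escape N); rewrite ?addn0 ?add0n.
Qed.

Lemma kappa_gt0 N sigma z : 0 < kappa N sigma z.
Proof.
rewrite mulr_gt0 ?subr_gt0 ?expRN1_lt1 // exprn_gt0 // invr_gt0 ltr0n.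
by rewrite muln_gt0 dim_gt0.
Qed.

Lemma kappa_le1 N sigma z : kappa N sigma z <= 1.
Proof.
have e0 := expR_ge0 (-1 : R); have e1 := expRN1_lt1.
apply: mulr_ile1; rewrite ?exprn_ge0 ?invr_ge0 //.
by rewrite exprn_ile1 ?invr_ge0 // invf_le1 ?ler1n ?ltr0n muln_gt0 dim_gt0.
Qed.


Lemma ln_le_subr1 (t : R) : 0 < t -> ln t <= t - 1.
Proof. by move=> t0; have := @le_ln1Dx R (t - 1); rewrite subrKC; apply; lra. Qed.

Lemma expR1E : expR 1 = (expR (-1))^-1 :> R.
Proof. by rewrite expRN invrK. Qed.

(** Concavity of [ln] at the points 1 and [k], obtained from the tangent to the exponential at
    [mu = D * ln k]. *)
Lemma ln_ge_chord (D k : R) : 0 < k -> 0 <= D <= 1 ->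
  D * ln k <= ln ((1 - D) + D * k).
Proof.
move=> k0 /andP[D0 D1]; rewrite -[leLHS]expRK.
have pos : 0 < 1 - D + D * k.
  have [->|Dn0] := eqVneq D 0; first by rewrite subr0 mul0r addr0.
  by apply: ltr_wpDl; rewrite ?subr_ge0 // mulr_gt0 // lt_neqAle eq_sym Dn0.
rewrite ler_ln ?posrE ?expR_gt0 //.
set a := ln k; set mu := D * a.
have h1 : expR mu * (1 + (a - mu)) <= k.
  rewrite -[leRHS](@lnK _ k) // -/a -[X in _ <= expR X](subrKC mu a) expRD.
  by apply: ler_wpM2l; rewrite ?expR_ge0 // expR_ge1Dx.
have h2 : expR mu * (1 - mu) <= 1.
  rewrite -[leRHS]expR0 -[X in _ <= expR X](subrr mu) expRD.
  by apply: ler_wpM2l; rewrite ?expR_ge0 // expR_ge1Dx.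
have h3 : (1 - D) * (expR mu * (1 - mu)) <= (1 - D) * 1 by rewrite ler_wpM2l // subr_ge0.
have h4 : D * (expR mu * (1 + (a - mu))) <= D * k by rewrite ler_wpM2l.
have : expR mu = (1 - D) * (expR mu * (1 - mu)) + D * (expR mu * (1 + (a - mu))).
  by rewrite /mu; ring.
lra.
Qed.

(** * Switching a single site between empty and obstacle *)

Section Flip.
Variables (N : nat) (y x z : 'rV[int]_d) (sigma : 'rV[int]_d -> bool).
Hypotheses (zy : z != y) (xyN : (l1 (x - y) <= N)%N).

Let w := bweight sigma.
Let u0 := psum N y (upd w z 0) x.
Let u1 := psum N y (upd w z 1) x.
Let ue := psum N y (upd w z (expR (-1))) x.

Lemma cost_upd_true : cost N y (upd sigma z true) x = - ln ue.
Proof. by rewrite /cost bweight_upd. Qed.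

Lemma cost_upd_false : cost N y (upd sigma z false) x = - ln u1.
Proof. by rewrite /cost bweight_upd. Qed.

Let u1_gt0 : 0 < u1.
Proof. by have := psum_gt0 (upd sigma z false) xyN; rewrite bweight_upd. Qed.

Let ue_gt0 : 0 < ue.
Proof. by have := psum_gt0 (upd sigma z true) xyN; rewrite bweight_upd. Qed.

Let u0_ge0 : 0 <= u0.
Proof. by apply: psum_ge0; apply: upd_ge0 => // v; exact: bweight_ge0. Qed.

Let u0_le_ue : u0 <= ue.
Proof.
apply: psum_le => v; last by apply: upd_le; exact: expR_ge0.
by apply: upd_ge0 => // v'; exact: bweight_ge0.
Qed.

Let ue_le_u1 : ue <= u1.
Proof.
apply: psum_le => v; last by apply: upd_le; exact/ltW/expRN1_lt1.
by apply: upd_ge0 => [v'|]; [exact: bweight_ge0|exact: expR_ge0].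
Qed.

Let hitE : hitprob N y sigma x z = 1 - u0 / psum N y w x.
Proof. by rewrite /hitprob mulrBl divff // gt_eqF // psum_gt0. Qed.

Let wz : w z = expR (-1) \/ w z = 1.
Proof. by rewrite /w /bweight; case: ifP; [left|right]. Qed.

Lemma hitprob_falseE : hitprob N y (upd sigma z false) x z = (u1 - u0) / u1.
Proof.
rewrite /hitprob !bweight_upd -/u1 -/w.
by have -> : upd (upd w z 1) z 0 = upd w z 0 by apply/funext => v; rewrite /upd; case: eqP.
Qed.

(** The visiting probability is [1 - u0 / u] with [u] equal to [ue] or [u1] according to the state
    of [z], and this increases with [u]. *)
Let hit_bounds : (ue - u0) / ue <= hitprob N y sigma x z <= (u1 - u0) / u1.
Proof.
rewrite hitE !mulrBl !divff ?gt_eqF // !lerD2l !lerN2.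
suff /andP[h1 h2] : ue <= psum N y w x <= u1.
  by apply/andP; split; apply: ler_wpM2l => //; rewrite lef_pV2 ?posrE // psum_gt0.
rewrite -[X in _ <= psum _ _ X _ <= _](@upd_id _ _ w z).
by case: wz => ->; rewrite ?lexx ?ue_le_u1.
Qed.

Lemma cost_flip_ge :
  (1 - expR (-1)) * hitprob N y sigma x z
  <= cost N y (upd sigma z true) x - cost N y (upd sigma z false) x.
Proof.
rewrite cost_upd_true cost_upd_false opprK [X in _ <= X]addrC -ln_div ?posrE //.
have H : ue <= u0 + expR (-1) * (u1 - u0).
  apply: psum_upd_le => //; first by move=> v; exact: bweight_ge0.
  by rewrite expR_ge0 ltW // expRN1_lt1.
have h1 : ln (ue / u1) <= ue / u1 - 1 by apply: ln_le_subr1; rewrite divr_gt0.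
have h2 : ue / u1 <= (u0 + expR (-1) * (u1 - u0)) / u1 by rewrite ler_pM2r ?invr_gt0.
have h3 : (1 - expR (-1)) * hitprob N y sigma x z <= (1 - expR (-1)) * ((u1 - u0) / u1).
  by apply: ler_wpM2l; [rewrite subr_ge0 ltW // expRN1_lt1 | case/andP: hit_bounds].
have h4 : (u0 + expR (-1) * (u1 - u0)) / u1 = 1 - (1 - expR (-1)) * ((u1 - u0) / u1).
  by field; rewrite gt_eqF.
have -> : ln (u1 / ue) = - ln (ue / u1) by rewrite -lnV ?posrE ?divr_gt0 // invf_div.
lra.
Qed.

Let kap := kappa N sigma z.

Let ue_ge : u0 + expR (-1) * kap * (u1 - u0) <= ue.
Proof.
apply: psum_upd_ge => //.
- by move=> v; exact: bweight_ge0.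
- exact/ltW/kappa_gt0.
- rewrite -[leRHS]mulr1; apply: ler_pM.
  + exact: expR_ge0.
  + exact/ltW/kappa_gt0.
  + exact/ltW/expRN1_lt1.
  + exact: kappa_le1.
- by move=> k kN; apply: rod_avg_escape; exact: ltnW.
Qed.

(** By [ln t <= t - 1] the increase is at most [(u1 - u0) / ue], and [ue_ge] bounds [u1 - u0] by
    [expR 1 / kap] times [ue - u0], the mass of the paths through [z] when it is an obstacle. *)
Lemma cost_flip_le :
  cost N y (upd sigma z true) x - cost N y (upd sigma z false) x
  <= expR 1 / kap * hitprob N y sigma x z.
Proof.
have k0 : 0 < kap by exact: kappa_gt0.
have e0 : 0 < expR (-1 : R) by exact: expR_gt0.
rewrite cost_upd_true cost_upd_false opprK [X in X <= _]addrC -ln_div ?posrE //.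
apply: (@le_trans _ _ (u1 / ue - 1)); first by apply: ln_le_subr1; rewrite divr_gt0.
rewrite expR1E -invfM [leRHS]mulrC ler_pdivlMr; last exact: mulr_gt0.
apply: le_trans (andP hit_bounds).1.
have -> : u1 / ue - 1 = (u1 - ue) / ue by field; rewrite gt_eqF.
rewrite mulrAC ler_pM2r ?invr_gt0 //.
apply: (@le_trans _ _ ((u1 - u0) * (expR (-1) * kap))).
  by apply: ler_wpM2r; [rewrite mulr_ge0 // ltW|rewrite lerD2l lerN2].
by rewrite mulrC lerBrDl; exact: ue_ge.
Qed.

(** Concavity of the logarithm is applied to [ue / u1] itself, so that only [ln kap] remains, linear
    in the rod length. The price is the denominator [u1], that is, the visiting probability with [z]
    emptied. *)
Lemma cost_flip_le_ln :
  cost N y (upd sigma z true) x - cost N y (upd sigma z false) x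
  <= ln (expR 1 / kap) * hitprob N y (upd sigma z false) x z.
Proof.
have k0 : 0 < kap by exact: kappa_gt0.
have e0 : 0 < expR (-1 : R) by exact: expR_gt0.
rewrite cost_upd_true cost_upd_false opprK [X in X <= _]addrC -ln_div ?posrE //.
rewrite hitprob_falseE; set D := _ / u1.
have D01 : 0 <= D <= 1.
  rewrite divr_ge0 ?(ltW u1_gt0) ?subr_ge0 ?(le_trans u0_le_ue) //=.
  by rewrite ler_pdivrMr // mul1r lerBlDr lerDl.
have ek : 0 < expR (-1) * kap by rewrite mulr_gt0.
rewrite expR1E -invfM; have H := ln_ge_chord ek D01.
have h : ln (1 - D + D * (expR (-1) * kap)) <= ln (ue / u1).
  rewrite ler_ln ?posrE ?divr_gt0 //; last first.
    have [D0|Dn0] := eqVneq D 0; first by rewrite D0 subr0 mul0r addr0.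
    case/andP: D01 => D0 D1.
    by apply: ltr_wpDl; rewrite ?subr_ge0 // mulr_gt0 // lt_neqAle eq_sym Dn0.
  rewrite ler_pdivlMr //; apply: le_trans ue_ge; rewrite le_eqVlt; apply/orP; left.
  by apply/eqP; rewrite /D; field; rewrite gt_eqF.
have -> : u1 / ue = (ue / u1)^-1 by rewrite invf_div.
rewrite !lnV ?posrE ?divr_gt0 // mulNr lerN2 mulrC; exact: le_trans H h.
Qed.

End Flip.
End Sensitivity.

(** * Bernoulli expectations *)

Section BernoulliExp.
Variables (R : realType) (T : eqType).
Implicit Types (r : R) (s : seq T) (F G : (T -> bool) -> R) (sigma : T -> bool).

(* Expectation over the configurations with independent sites, each of [s] being
   empty with probability [r], and equal to [sigma] outside [s]. *)
Fixpoint bexp r s F sigma : R :=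
  if s is z :: s'
  then r * bexp r s' F (upd sigma z false) + (1 - r) * bexp r s' F (upd sigma z true)
  else F sigma.

Definition indep_of (z : T) F := forall sigma b, F (upd sigma z b) = F sigma.

Lemma upd_comm sigma z z' b b' : z != z' ->
  upd (upd sigma z b) z' b' = upd (upd sigma z' b') z b.
Proof.
move=> zz'; apply/funext => x; rewrite /upd.
by case: eqP => // ->; rewrite eq_sym (negPf zz').
Qed.

Lemma upd_upd sigma z b b' : upd (upd sigma z b) z b' = upd sigma z b'.
Proof. by apply/funext => x; rewrite /upd; case: eqP. Qed.

Lemma bexp_ext r s F G sigma : (forall sigma, F sigma = G sigma) ->
  bexp r s F sigma = bexp r s G sigma.
Proof. by move=> FG; congr bexp; apply/funext. Qed.

Lemma bexpD r s F G sigma :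
  bexp r s (fun t => F t + G t) sigma = bexp r s F sigma + bexp r s G sigma.
Proof. by elim: s sigma => //= z s IHs sigma; rewrite !IHs; ring. Qed.

Lemma bexpZ r s c F sigma :
  bexp r s (fun t => c * F t) sigma = c * bexp r s F sigma.
Proof. by elim: s sigma => //= z s IHs sigma; rewrite !IHs; ring. Qed.

Lemma bexpB r s F G sigma :
  bexp r s (fun t => F t - G t) sigma = bexp r s F sigma - bexp r s G sigma.
Proof. by elim: s sigma => //= z s IHs sigma; rewrite !IHs; ring. Qed.

Lemma bexp_cst r s c sigma : bexp r s (fun=> c) sigma = c.
Proof. by elim: s sigma => //= z s IHs sigma; rewrite !IHs; ring. Qed.

Lemma bexp_sum r s (I : Type) (l : seq I) (P : pred I) (F : I -> (T -> bool) -> R) sigma :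
  bexp r s (fun t => \sum_(i <- l | P i) F i t) sigma
  = \sum_(i <- l | P i) bexp r s (F i) sigma.
Proof.
elim: l => [|i l IHl].
  rewrite big_nil -[RHS](bexp_cst r s 0 sigma); apply: bexp_ext => t.
  by rewrite big_nil.
rewrite big_cons; case: ifPn => Pi; rewrite -IHl -?bexpD; apply: bexp_ext => t;
  by rewrite big_cons ?Pi ?(negPf Pi).
Qed.

Lemma bexp_le r s F G sigma : 0 <= r <= 1 -> (forall t, F t <= G t) ->
  bexp r s F sigma <= bexp r s G sigma.
Proof.
move=> /andP[r0 r1] FG; elim: s sigma => //= z s IHs sigma.
by apply: lerD; apply: ler_wpM2l; rewrite ?subr_ge0.
Qed.

Lemma bexp_ge0 r s F sigma : 0 <= r <= 1 -> (forall t, 0 <= F t) ->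
  0 <= bexp r s F sigma.
Proof. by move=> r01 F0; rewrite -(bexp_cst r s 0 sigma); exact: bexp_le. Qed.

Lemma bexp_comp_upd r s F z b sigma : z \notin s ->
  bexp r s (fun t => F (upd t z b)) sigma = bexp r s F (upd sigma z b).
Proof.
elim: s sigma => //= x s IHs sigma; rewrite inE negb_or => /andP[zx zs].
by rewrite !IHs // !(@upd_comm sigma z) // ![upd (upd _ x _) _ _]upd_comm // eq_sym.
Qed.

Lemma bexp_boundary r s F G sigma :
  (forall t, (forall z, z \notin s -> t z = sigma z) -> F t = G t) ->
  bexp r s F sigma = bexp r s G sigma.
Proof.
elim: s sigma => [|x s IHs] sigma /= FG; first exact: FG.
by congr (_ * _ + _ * _); apply: IHs => t tE; apply: FG => z;
  rewrite inE negb_or => /andP[zx zs]; rewrite tE // /upd (negPf zx).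
Qed.

Lemma bexp_site r s z (f : bool -> R) G sigma :
  uniq s -> z \in s -> indep_of z G ->
  bexp r s (fun t => f (t z) * G t) sigma =
  (r * f false + (1 - r) * f true) * bexp r s G sigma.
Proof.
move=> + + Gz; elim: s sigma => //= x s IHs sigma /andP[xs us].
rewrite inE => /predU1P[zx|zs]; last by rewrite !IHs //; ring.
rewrite -zx in xs *.
have E b : bexp r s (fun t => f (t z) * G t) (upd sigma z b) =
    f b * bexp r s G (upd sigma z b).
  rewrite -bexpZ; apply: bexp_boundary => t tE; congr (f _ * _).
  by rewrite (tE z xs) /upd eqxx.
have E' b : bexp r s G (upd sigma z b) = bexp r s G sigma.
  by rewrite -bexp_comp_upd //; apply: bexp_ext => t; exact: Gz.
by rewrite !E !E'; ring.
Qed.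

Lemma bexp_prod r s (l : seq T) (f : bool -> R) sigma :
  uniq s -> uniq l -> {subset l <= s} ->
  bexp r s (fun t => \prod_(z <- l) f (t z)) sigma =
  (r * f false + (1 - r) * f true) ^+ size l.
Proof.
move=> us; elim: l => [|z l IHl] /=.
  move=> _ _; rewrite expr0 -[RHS](bexp_cst r s 1 sigma).
  by apply: bexp_ext => t; rewrite big_nil.
move=> /andP[zl ul] ls.
have -> : bexp r s (fun t => \prod_(z <- z :: l) f (t z)) sigma =
   bexp r s (fun t => f (t z) * \prod_(z <- l) f (t z)) sigma.
  by apply: bexp_ext => t; rewrite big_cons.
rewrite bexp_site //; last first.
- move=> t b; apply: eq_big_seq => v vl; rewrite /upd; case: eqP => // vz.
  by rewrite vz (negPf zl) in vl.
- by apply: ls; rewrite inE eqxx.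
by rewrite IHl ?exprS // => v vl; apply: ls; rewrite inE vl orbT.
Qed.

Definition flipdiff F z sigma := F (upd sigma z true) - F (upd sigma z false).

(** Restrict to the event that [z] is empty: it has probability [r] and is independent of the
    configuration with [z] emptied. *)
Lemma bexp_site_le r s z F sigma : uniq s -> z \in s -> 0 <= r <= 1 ->
  (forall t, 0 <= F t) ->
  r * bexp r s (fun t => F (upd t z false)) sigma <= bexp r s F sigma.
Proof.
move=> us zs r01 F0; case/andP: (r01) => r0 r1.
have /= := @bexp_site r s z (fun b => if b then 0 else 1)
  (fun t => F (upd t z false)) sigma us zs.
rewrite mulr0 addr0 mulr1 => <-; last by move=> t b; rewrite upd_upd.
apply: bexp_le => // t; case: (boolP (t z)) => tz; first by rewrite mul0r.
by rewrite mul1r -(negPf tz) upd_id.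
Qed.

(** Russo's formula, here for arbitrary [F]: by the product rule along the recursion, each site
    contributes minus its flip difference. *)
Lemma is_derive_bexp s F sigma r : uniq s ->
  is_derive r 1 (fun r => bexp r s F sigma)
    (- \sum_(z <- s) bexp r s (flipdiff F z) sigma).
Proof.
elim: s sigma => [|x s IHs] sigma /=.
  by move=> _; rewrite big_nil oppr0; exact: is_derive_cst.
move=> /andP[xs us].
have H0 := IHs (upd sigma x false) us; have H1 := IHs (upd sigma x true) us.
apply: is_derive_eq.
rewrite big_cons /= !bexpB !bexp_comp_upd // !upd_upd big_split /= -!mulr_sumr.
by rewrite /GRing.scale /=; ring.
Qed.

Lemma bexp_mvt s F sigma p q : uniq s -> p < q ->
  exists2 c, p < c < q & bexp p s F sigma - bexp q s F sigma =
    (q - p) * \sum_(z <- s) bexp c s (flipdiff F z) sigma.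
Proof.
move=> us pq.
have der r := is_derive_bexp F sigma r us.
have [|c cpq E] := @MVT R _ _ p q pq (fun x _ => der x).
- by apply: derivable_within_continuous => x _; exact: ex_derive.
exists c; first by rewrite in_itv in cpq.
by rewrite -[LHS]opprB E; ring.
Qed.

End BernoulliExp.

(** * The number of visited sites *)

Section RangeMoment.
Variables (R : realType) (d : nat) (i0 : 'I_d).
Implicit Types (x y z v : 'rV[int]_d) (sigma : 'rV[int]_d -> bool) (n : nat).

(** Jensen's inequality for the probability proportional to [W], from the tangent to the exponential
    at the mean [mu]. *)
Lemma jensen_ln (I : eqType) (l : seq I) (W X : I -> R) :
  (forall i, 0 <= W i) -> 0 < \sum_(i <- l) W i ->
  (\sum_(i <- l) W i * X i) / (\sum_(i <- l) W i) <=
  ln ((\sum_(i <- l) W i * expR (X i)) / (\sum_(i <- l) W i)).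
Proof.
move=> W0; set U := \sum_(i <- l) W i => U0; set mu := _ / U.
have muE : \sum_(i <- l) W i * X i = mu * U by rewrite divfK // gt_eqF.
have H : expR mu <= (\sum_(i <- l) W i * expR (X i)) / U.
  rewrite ler_pdivlMr //.
  have -> : expR mu * U = \sum_(i <- l) W i * (expR mu * (1 + (X i - mu))).
    transitivity (\sum_(i <- l) (expR mu * (1 - mu) * W i + expR mu * (W i * X i))).
      by rewrite big_split /= -!mulr_sumr muE -/U; ring.
    by apply: eq_bigr => i _; ring.
  apply: ler_sum => i _; apply: ler_wpM2l => //.
  rewrite -[X in _ <= expR X](subrKC mu) expRD.
  by apply: ler_wpM2l; rewrite ?expR_ge0 // expR_ge1Dx.
rewrite -[leLHS]expRK ler_ln ?posrE ?expR_gt0 //.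
exact: lt_le_trans (expR_gt0 _) H.
Qed.

(** Keeping one factor per distinct site makes the factors independent under the environment. *)
Lemma prod_undup_le (w : 'rV[int]_d -> R) p :
  (forall z, 0 <= w z) -> (forall z, w z <= 1) ->
  \prod_(z <- p) w z <= \prod_(z <- undup p) w z.
Proof.
move=> w0 w1; elim: p => [|z p IHp] /=; first by rewrite !big_nil.
rewrite big_cons; case: ifPn => _.
  apply: le_trans IHp; apply: ler_piMl => //; exact: prodr_ge0.
by rewrite big_cons; apply: ler_wpM2l.
Qed.

Lemma hitprob_ge0 N y sigma x z : 0 <= hitprob R N y sigma x z.
Proof.
rewrite /hitprob divr_ge0 ?psum_ge0 //; last by move=> u; exact: bweight_ge0.
rewrite psum_visit; apply: sumr_ge0 => p _; apply: pweight_ge0; exact: bweight_ge0.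
Qed.

Definition mean_range N y sigma x (s : seq 'rV[int]_d) : R :=
  \sum_(z <- s) hitprob R N y sigma x z.

Lemma sum_hitprob N y sigma x (s : seq 'rV[int]_d) (f : 'rV[int]_d -> R) :
  uniq s -> (forall p, p \in paths N y x -> {subset p <= s}) ->
  \sum_(z <- s) hitprob R N y sigma x z * f z =
  (\sum_(p <- paths N y x) pweight (bweight R sigma) p * \sum_(z <- undup p) f z)
  / psum N y (bweight R sigma) x.
Proof.
move=> us ps; rewrite -(sum_visit _ _ us ps) mulr_suml; apply: eq_bigr => z _.
by rewrite /hitprob mulrAC.
Qed.

Lemma mean_rangeE N y sigma x (s : seq 'rV[int]_d) :
  uniq s -> (forall p, p \in paths N y x -> {subset p <= s}) ->
  mean_range N y sigma x s =
  (\sum_(p <- paths N y x) pweight (bweight R sigma) p * (size (undup p))%:R)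
  / psum N y (bweight R sigma) x.
Proof.
move=> us ps; have := sum_hitprob sigma (fun=> 1) us ps.
under eq_bigr do rewrite mulr1.
rewrite /mean_range => ->; congr (_ / _); apply: eq_bigr => p _.
by rewrite big_const_seq count_predT iter_addr_0.
Qed.

Lemma mean_range_ge N y sigma x (s : seq 'rV[int]_d) :
  uniq s -> (forall p, p \in paths N y x -> {subset p <= s}) ->
  (l1 (x - y) <= N)%N ->
  (l1 (x - y))%:R <= mean_range N y sigma x s.
Proof.
move=> us ps xyN; rewrite mean_rangeE // ler_pdivlMr; last exact: (@psum_gt0 R d i0).
rewrite /psum mulr_sumr big_seq [leRHS]big_seq; apply: ler_sum => p pp.
rewrite mulrC; apply: ler_wpM2l; first by apply: pweight_ge0; exact: bweight_ge0.
by rewrite ler_nat (l1_le_range pp).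
Qed.

(** Let [V] be the path sum with an extra factor [expR lam] per distinct visited site and [U] the
    plain one. Jensen gives [lam * mean_range <= ln V - ln U], and [ln V <= V - 1]. In the mean over
    the environment each visited site contributes at most [expR lam * (r + (1 - r) * expR (-1)) <=
    1], so [V] has mean at most 1 and only the bound on the cost [- ln U] is left. *)
Lemma bexp_mean_range N y x (s : seq 'rV[int]_d) r lam eta :
  uniq s -> (forall p, p \in paths N y x -> {subset p <= s}) ->
  (l1 (x - y) <= N)%N -> 0 <= r <= 1 -> 0 <= lam ->
  expR lam * (r + (1 - r) * expR (-1)) <= 1 ->
  lam * bexp r s (fun sigma => mean_range N y sigma x s) eta
  <= (l1 (x - y))%:R * (1 + ln (2 * d)%:R).
Proof.
move=> us ps xyN r01 lam0 lam1; have d0 := dim_gt0 i0.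
pose V sigma := \sum_(p <- paths N y x)
   pweight (bweight R sigma) p * expR (lam * (size (undup p))%:R).
have W0 sigma p : 0 <= pweight (bweight R sigma) p.
  by apply: pweight_ge0; exact: bweight_ge0.
have ptw sigma : lam * mean_range N y sigma x s <=
    V sigma + ((l1 (x - y))%:R * (1 + ln (2 * d)%:R) - 1).
  have U0 := @psum_gt0 R d i0 N y sigma x xyN.
  have V0 : 0 < V sigma.
    apply: (lt_le_trans U0); apply: ler_sum => p _.
    by rewrite ler_peMr // -expR0 ler_expR mulr_ge0.
  rewrite mean_rangeE // mulrA mulr_sumr.
  under eq_bigr do rewrite mulrCA.
  apply: le_trans (jensen_ln _ _ _) _ => //.
  rewrite -/(V sigma) ln_div ?posrE //.
  have := @cost_le R d i0 N y sigma x xyN; rewrite /cost.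
  have := @ln_le_subr1 R _ V0.
  by rewrite -/(psum N y (bweight R sigma) x); lra.
rewrite -bexpZ; apply: le_trans (bexp_le _ _ r01 ptw) _.
rewrite bexpD bexp_cst.
suff : bexp r s V eta <= 1 by lra.
rewrite bexp_sum.
apply: le_trans (@psum_le1 R d N y (fun=> 1) x d0 _ _) => //.
rewrite /psum big_seq [leRHS]big_seq; apply: ler_sum => p pp.
have c0 : 0 <= (2 * d)%:R^-1 ^+ size p :> R by rewrite exprn_ge0 // invr_ge0.
have -> : pweight (fun=> 1) p = (2 * d)%:R^-1 ^+ size p :> R.
  rewrite /pweight; under eq_bigr do rewrite mul1r.
  by rewrite big_const_seq count_predT iter_mulr_1.
apply: (@le_trans _ _ ((2 * d)%:R^-1 ^+ size p * bexp r s (fun sigma =>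
   \prod_(z <- undup p) (if sigma z then expR (lam - 1) else expR lam)) eta)).
  rewrite -bexpZ; apply: bexp_le => // sigma.
  rewrite /pweight big_split /= [X in _ * X * _]big_const_seq count_predT iter_mulr_1.
  rewrite [X in X * expR _]mulrC -mulrA; apply: ler_wpM2l => //.
  apply: (@le_trans _ _
    (\prod_(z <- undup p) bweight R sigma z * expR (lam * (size (undup p))%:R))).
    apply: ler_wpM2r; first exact: expR_ge0.
    by apply: prod_undup_le; [exact: bweight_ge0|exact: bweight_le1].
  rewrite mulrC expRM_natr -[X in X * _](iter_mulr_1) -count_predT -big_const_seq -big_split /=.
  apply: ler_prod => z _; rewrite /bweight; case: ifP => _; rewrite ?mulr1 ?lexx ?expR_ge0 //=.
  by rewrite mulr_ge0 ?expR_ge0 // expRD lexx.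
have sub : {subset undup p <= s} by move=> z; rewrite mem_undup; exact: ps.
rewrite (@bexp_prod R _ r s _
  (fun b : bool => if b then expR (lam - 1) else expR lam)) ?undup_uniq //.
apply: ler_piMr => //; apply: exprn_ile1.
  by case/andP: r01 => r0 r1; rewrite addr_ge0 // mulr_ge0 ?expR_ge0 ?subr_ge0.
by rewrite expRD; move: lam1; lra.
Qed.
End RangeMoment.

(** * Coarse walks *)

Section Nets.
Variable d : nat.
Implicit Types (x y z c : 'rV[int]_d).

Definition box (M : nat) : seq 'rV[int]_d :=
  map (fun f : {ffun 'I_d -> 'I_(2 * M).+1} => \row_i ((f i : nat)%:Z - M%:Z))
    (enum predT).

Lemma size_box M : size (box M) = ((2 * M).+1 ^ d)%N.
Proof. by rewrite size_map -cardE card_ffun !card_ord. Qed.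

Lemma mem_box M x : (l1 x <= M)%N -> x \in box M.
Proof.
move=> xM; have xi i : (absz (x ord0 i) <= M)%N.
  by apply: leq_trans xM; rewrite /l1 (bigD1 i) //= leq_addr.
apply/mapP; exists [ffun i => inord (absz (x ord0 i + M%:Z))]; first by rewrite mem_enum.
apply/rowP => i; rewrite mxE ffunE inordK; have := xi i; move: (x ord0 i) => a; lia.
Qed.

Fixpoint cwalks (B : seq 'rV[int]_d) (l : nat) x : seq (seq 'rV[int]_d) :=
  if l is l'.+1
  then [seq x :: v | v <- flatten [seq cwalks B l' (x + e) | e <- B]]
  else [:: [:: x]].

Lemma size_cwalks B l x : size (cwalks B l x) = (size B ^ l)%N.
Proof.
elim: l x => //= l IHl x.
rewrite size_map size_flatten /shape -map_comp.
rewrite (eq_map (g := fun=> (size B ^ l)%N)); last by move=> e /=; rewrite IHl.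
by rewrite sumnE big_map big_const_seq count_predT iter_addn_0 mulnC expnS.
Qed.

Lemma size_mem_cwalks B l x v : v \in cwalks B l x -> size v = l.+1.
Proof.
elim: l x v => [|l IHl] x v /=; first by rewrite inE => /eqP ->.
by move=> /mapP[v' /flattenP[_ /mapP[e _ ->] /IHl sv'] ->] /=; rewrite sv'.
Qed.

Lemma mem_cwalks B x q : path (fun u v => v - u \in B) x q ->
  x :: q \in cwalks B (size q) x.
Proof.
elim: q x => [|v q IHq] x /=; first by rewrite inE.
move=> /andP[xv pq]; apply/mapP; exists (v :: q) => //.
apply/flattenP; exists (cwalks B (size q) v); last exact: IHq.
by apply/mapP; exists (v - x) => //; rewrite subrKC.
Qed.

(** A separated and covering subset of the chain, with a walk through it. Separation by 2M + 1 makes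
    the balls of radius M around net points disjoint. A new net point is one step of the chain
    beyond the cover of radius 2M, whence jumps of at most 2M + 1; the length of the walk is that of
    a tree traversal. *)
Record is_net (M : nat) x q (net vq : seq 'rV[int]_d) : Prop := IsNet {
  net_uniq : uniq net ;
  net_walk : path (fun u v => (l1 (v - u) <= (2 * M).+1)%N) x vq ;
  net_size : size vq = (2 * (size net).-1)%N ;
  net_gt0 : (0 < size net)%N ;
  net_chain : {subset net <= x :: q} ;
  net_visited : {subset net <= x :: vq} ;
  net_separated : forall c c', c \in net -> c' \in net -> c != c' ->
    ((2 * M).+1 <= l1 (c - c'))%N ;
  net_cover : forall z, z \in x :: q ->
    exists2 c, c \in net & (l1 (z - c) <= 2 * M)%N }.

(* A new net point is reached by a two-step excursion from an old one, so the
   walk through the net has length linear in the size of the net. *)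
Lemma exists_net M x q : path (@adj d) x q -> exists net vq, is_net M x q net vq.
Proof.
have l10 : l1 (0 : 'rV[int]_d) = 0%N by apply/eqP; rewrite l1_eq0.
elim/last_ind: q => [_|q z IHq].
  exists [:: x], [::]; split => //.
  - by move=> c c'; rewrite !inE => /eqP -> /eqP ->; rewrite eqxx.
  - by move=> z; rewrite inE => /eqP ->; exists x; rewrite ?inE // subrr l10.
rewrite rcons_path => /andP[/IHq [net [vq [un wn sn n0 cn vn pn con]]] az].
have memz u : (u \in x :: rcons q z) = (u == z) || (u \in x :: q).
  by rewrite -rcons_cons mem_rcons inE.
case: (boolP (has (fun c => l1 (z - c) <= 2 * M)%N net)) => [/hasP[c cnet zc]|far].
  exists net, vq; split => // [u /cn uq|u].
    by rewrite memz uq orbT.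
  by rewrite memz => /predU1P[->|/con //]; exists c.
have [c cnet lc] := con (last x q) (mem_last x q).
have zc : (l1 (z - c) <= (2 * M).+1)%N.
  by have [+ _] := l1_nbrs c az; lia.
have farc c' : c' \in net -> ((2 * M).+1 <= l1 (z - c'))%N.
  by move=> /(hasPn far); rewrite -ltnNge.
have znet : z \notin net.
  by apply/negP => /farc; rewrite subrr l10.
have cvn := vn c cnet; case/splitPl: cvn wn sn vn => p1 p2 lp1 wn sn vn.
exists (z :: net), (p1 ++ z :: c :: p2); split.
- by rewrite /= znet.
- move: wn; rewrite !cat_path /= lp1 => /andP[-> ->].
  by rewrite zc l1B zc.
- by move: sn; rewrite !size_cat /=; move: (size net) n0 => [|k] //= _; lia.
- by [].
- move=> u; rewrite memz inE => /predU1P[->|/cn ->]; rewrite ?eqxx ?orbT //.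
- move=> u; rewrite inE => /predU1P[->|/vn].
    by rewrite inE mem_cat inE eqxx !orbT.
  by rewrite !(inE, mem_cat) => /or3P[->|->|->]; rewrite ?orbT.
- move=> c1 c2; rewrite !inE => /predU1P[->|c1n] /predU1P[->|c2n] c12.
  + by rewrite eqxx in c12.
  + exact: farc.
  + by rewrite l1B; exact: farc.
  + exact: pn.
- move=> u; rewrite memz => /predU1P[->|/con[c' c'n uc']].
    by exists z; rewrite ?inE ?eqxx // subrr l10.
  by exists c' => //; rewrite inE c'n orbT.
Qed.

Lemma uniq_size_le1 (T : eqType) (s : seq T) : uniq s ->
  (forall a b, a \in s -> b \in s -> a = b) -> (size s <= 1)%N.
Proof.
case: s => [|a [|b s]] //= /andP[+ _] ab.
by rewrite (ab a b) ?inE ?eqxx ?orbT.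
Qed.

(** The chain joins each net point to another one, at distance at least 2M + 1, and so meets every
    sphere of radius below [M] around it: [M] distinct sites per net point, in disjoint balls. A
    second net point is needed for this. *)
Lemma net_count M x q net vq : path (@adj d) x q -> is_net M x q net vq ->
  (1 < size net)%N -> (size net * M <= size (undup (x :: q)))%N.
Proof.
move=> aq [un _ _ _ cn _ pn _] n1; set A := undup (x :: q).
have l10 : l1 (0 : 'rV[int]_d) = 0%N by apply/eqP; rewrite l1_eq0.
have ball c : c \in net -> (M <= count (fun z => l1 (z - c) < M)%N A)%N.
  move=> cnet.
  have [c' c'net cc'] : exists2 c', c' \in net & c' != c.
    have /allPn[c' c'n cc'] : ~~ all (pred1 c) net; last by exists c'.
    apply/negP => /allP al; have := uniq_size_le1 un.
    rewrite leqNgt n1 => H; suff : false by [].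
    by apply: H => a b /al /eqP -> /al /eqP ->.
  rewrite -size_filter -{1}(size_iota 0 M).
  rewrite -(size_map (fun z => l1 (z - c))); apply: uniq_leq_size.
    exact: iota_uniq.
  move=> k; rewrite mem_iota /= add0n => kM.
  have [||||z zq zk] := @chain_ivt d c x q c c' k aq.
  - exact: cn.
  - exact: cn.
  - by rewrite subrr l10.
  - by apply: leq_trans (pn c' c c'net cnet cc'); lia.
  by apply/mapP; exists z => //; rewrite mem_filter zk kM mem_undup.
have : (\sum_(c <- net) M <= \sum_(c <- net) count (fun z => l1 (z - c) < M)%N A)%N.
  by rewrite big_seq [leqRHS]big_seq; apply: leq_sum.
rewrite big_const_seq count_predT iter_addn_0 mulnC => /leq_trans; apply.
under eq_bigr do rewrite -sum1_count big_mkcond /=.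
rewrite exchange_big /= -sum1_size; apply: leq_sum => z _.
rewrite -big_mkcond sum1_count -size_filter; apply: uniq_size_le1.
  exact: filter_uniq.
move=> a b; rewrite !mem_filter => /andP[za an] /andP[zb bn].
apply/eqP; apply: contraT => /(pn a b an bn) ab.
suff : (l1 (a - b) <= 2 * M)%N by rewrite leqNgt ab.
have := l1D (a - z) (z - b); rewrite subrKA => /leq_trans; apply.
by rewrite (l1B a z) mul2n -addnn leq_add // ltnW.
Qed.

Definition tube (M : nat) (v : seq 'rV[int]_d) : seq 'rV[int]_d :=
  undup (flatten [seq [seq c + b | b <- box (2 * M)] | c <- v]).

Lemma size_tube M v : (size (tube M v) <= size v * (4 * M).+1 ^ d)%N.
Proof.
apply: leq_trans (size_undup _) _.
rewrite size_flatten /shape -map_comp sumnE big_map.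
under eq_bigr do rewrite /= size_map size_box.
by rewrite big_const_seq count_predT iter_addn_0 mulnC mulnA.
Qed.

Lemma path_tube M N y x p : (0 < M)%N -> p \in paths N y x ->
  exists j v, [/\ (j <= N)%N, v \in cwalks (box (2 * M).+1) (2 * j) x,
    {subset p <= tube M v} & (j * M <= size (undup p))%N].
Proof.
move=> M0 /mem_paths[pN yp [q [pq aq]]].
case: p pN yp pq => [|x' p] pN yp pq.
  by exists 0%N, [:: x]; split => //; rewrite inE.
move: pq => /= [x'x qE]; rewrite x'x {x'x} in pN yp *.
move: aq; rewrite -qE rcons_path => /andP[aq _].
have [net [vq nn]] := exists_net M aq.
(* One less than the net size, since a single net point gives no lower bound of order [M] on the
   number of visited sites. *)
exists (size net).-1, (x :: vq).
have bound : ((size net).-1 * M <= size (undup (x :: p)))%N.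
  have [n1|n1] := ltnP 1 (size net).
    apply: leq_trans (net_count aq nn n1); rewrite leq_mul2r leq_pred orbT //.
  by have -> : (size net).-1 = 0%N by lia.
split => //.
- apply: leq_trans pN; apply: leq_trans (size_undup _); apply: leq_trans bound.
  by rewrite leq_pmulr.
- rewrite -(net_size nn); apply: mem_cwalks.
  by apply: sub_path (net_walk nn) => u v; exact: mem_box.
- move=> z /(net_cover nn) [c /(net_visited nn) cv zc].
  rewrite mem_undup; apply/flattenP.
  exists [seq c + b | b <- box (2 * M)]; first by apply/mapP; exists c.
  by apply/mapP; exists (z - c); rewrite ?subrKC //; exact: mem_box.
Qed.

End Nets.

(** * Empty rods and greedy lattice animals *)

Section Rods.
Variables (R : realType) (d : nat) (i0 : 'I_d).
Implicit Types (x y z v : 'rV[int]_d) (sigma : 'rV[int]_d -> bool) (r : R).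
Implicit Types (s W : seq 'rV[int]_d).

Definition rod (m : nat) z : seq 'rV[int]_d := [seq rod_site i0 z j | j <- iota 0 m].

Definition empty_rod (m : nat) sigma z : bool := all (fun x => ~~ sigma x) (rod m z).

Lemma empty_rod_len N m sigma z : (m <= N)%N -> (m < rod_len i0 N sigma z)%N ->
  empty_rod m sigma z.
Proof.
rewrite /rod_len ltnS => mN mf; apply/allP => _ /mapP[j + ->].
rewrite mem_iota add0n /= => jm.
have jf := leq_trans jm mf.
have := before_find 0%N jf; rewrite nth_iota ?add0n; last exact: leq_trans jm mN.
by move=> ->.
Qed.

Lemma expr_rod_len (a : R) N sigma z : 1 <= a ->
  a ^+ rod_len i0 N sigma z <=
  a + \sum_(1 <= m < N.+1) a ^+ m.+1 * (empty_rod m sigma z)%:R.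
Proof.
move=> a1; have a0 : 0 <= a by exact: le_trans a1.
have s0 (P : pred nat) : 0 <= \sum_(1 <= m < N.+1 | P m) a ^+ m.+1 * (empty_rod m sigma z)%:R.
  by apply: sumr_ge0 => m _; rewrite mulr_ge0 ?exprn_ge0.
have lenN : (rod_len i0 N sigma z <= N.+1)%N.
  by rewrite /rod_len ltnS -[X in (_ <= X)%N](size_iota 0) find_size.
have : (0 < rod_len i0 N sigma z)%N by [].
case E : (rod_len i0 N sigma z) lenN => [//|[|m]] lenN _.
  by rewrite expr1 lerDl s0.
rewrite (bigD1_seq m.+1) ?iota_uniq //=; last by rewrite mem_index_iota ltnS.
rewrite (@empty_rod_len N) // ?E // mulr1 addrCA -[leLHS]addr0.
by rewrite lerD2l addr_ge0.
Qed.

(** An inequality because [l] may leave [s]: outside [s] the boundary configuration puts obstacles,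
    and the indicator vanishes. *)
Lemma bexp_empty r s (l : seq 'rV[int]_d) (G : ('rV[int]_d -> bool) -> R) :
  uniq s -> uniq l -> 0 <= r <= 1 -> (forall sigma, 0 <= G sigma) ->
  (forall x, x \in l -> indep_of x G) ->
  bexp r s (fun sigma => (all (fun x => ~~ sigma x) l)%:R * G sigma) (fun=> true)
  <= r ^+ size l * bexp r s G (fun=> true).
Proof.
move=> us + r01 G0; case/andP: (r01) => r0 r1.
elim: l => [|x l IHl] /= => [_ _|/andP[xl ul] Gl].
  by rewrite expr0 mul1r le_eqVlt; apply/orP; left; apply/eqP/bexp_ext => t; rewrite mul1r.
have {}IHl : bexp r s (fun sigma => (all (fun x => ~~ sigma x) l)%:R * G sigma) (fun=> true)
  <= r ^+ size l * bexp r s G (fun=> true).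
  by apply: IHl => // v vl; apply: Gl; rewrite inE vl orbT.
have E t : (~~ t x && all (fun x => ~~ t x) l)%:R * G t =
    (~~ t x)%:R * ((all (fun x => ~~ t x) l)%:R * G t).
  by rewrite mulrA -natrM mulnb.
rewrite (bexp_ext _ _ _ E) exprS.
have [xs|xs] := boolP (x \in s).
  rewrite (@bexp_site R _ r s x (fun b => (~~ b)%:R)) //=.
    by rewrite mulr1 mulr0 addr0 -mulrA; apply: ler_wpM2l.
  move=> t b; rewrite (Gl x) ?inE ?eqxx //; congr (_%:R * _).
  congr nat_of_bool; apply: eq_in_all => v vl; rewrite /upd; case: eqP => // vx.
  by rewrite -vx vl in xl.
rewrite (@bexp_boundary _ _ r s _ (fun=> 0)); last first.
  by move=> t /(_ x xs) ->; rewrite mul0r.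
by rewrite bexp_cst mulr_ge0 ?mulr_ge0 ?exprn_ge0 //; exact: bexp_ge0.
Qed.

Lemma mem_rod m z x : x \in rod m z ->
  exists2 j, (j < m)%N & x = rod_site i0 z j.
Proof. by move=> /mapP[j + ->]; rewrite mem_iota add0n => jm; exists j. Qed.

Lemma rod_site_inj z : injective (rod_site i0 z).
Proof.
move=> j k /rowP /(_ i0); rewrite !mxE !eqxx /=; move: (z 0 i0) => a; lia.
Qed.

(** Rods that meet have base points on one line in direction [i0], less than [m] apart; congruence
    modulo [m] then forces equality. *)
Lemma rod_disjoint (m : nat) z z' x : (0 < m)%N ->
  modz (z 0 i0) m%:Z = modz (z' 0 i0) m%:Z -> x \in rod m z -> x \in rod m z' -> z = z'.
Proof.
move=> m0 zz' /mem_rod[j jm xj] /mem_rod[k km xk].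
have E i : rod_site i0 z j 0 i = rod_site i0 z' k 0 i by rewrite -xj -xk.
have [c zc] : exists c : int, z 0 i0 - z' 0 i0 = c * m%:Z.
  by apply/dvdzP; rewrite -eqz_mod_dvd; apply/eqP.
have Ei : z 0 i0 + j%:Z = z' 0 i0 + k%:Z.
  have := E i0; rewrite !mxE !eqxx /=; move: (z 0 i0) (z' 0 i0) => a a'; lia.
have c0 : c = 0.
  move: zc Ei; move: (z 0 i0) (z' 0 i0) => a a' ac ajk.
  have : c * m%:Z = k%:Z - j%:Z by lia.
  have [c1|[c1|//]] : (1 <= c \/ c <= -1 \/ c = 0) by lia.
  - have : m%:Z <= c * m%:Z by rewrite ler_peMl.
    lia.
  - have : c * m%:Z <= - m%:Z by rewrite -mulN1r ler_wpM2r.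
    lia.
apply/rowP => i; have := E i; rewrite !mxE /=; have [->|ii0] := eqVneq i i0.
  by move=> _; move: zc; rewrite c0 mul0r => /eqP; rewrite subr_eq0 => /eqP.
by rewrite !mulr0 !addr0.
Qed.

(** The exponential of an indicator [1_A] is [1 + eR1 * 1_A]. *)
Definition eR1 : R := expR 1 - 1.

Lemma eR1_ge0 : 0 <= eR1.
Proof. by rewrite subr_ge0; apply: le_trans (expR_ge1Dx 1); rewrite lerDl. Qed.

Lemma bexp_rods_class r s W (m : nat) : (0 < m)%N ->
  uniq s -> uniq W -> 0 <= r <= 1 ->
  (forall z z', z \in W -> z' \in W -> modz (z 0 i0) m%:Z = modz (z' 0 i0) m%:Z) ->
  bexp r s (fun sigma => \prod_(z <- W) (1 + eR1 * (empty_rod m sigma z)%:R))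
    (fun=> true) <= (1 + eR1 * r ^+ m) ^+ size W.
Proof.
move=> m0 us + r01; case/andP: (r01) => r0 r1; have e0 := eR1_ge0.
elim: W => [|z W IHW] /= => [_ _|/andP[zW uW] Wmod].
  rewrite expr0 -[leRHS](bexp_cst r s 1 (fun=> true)); apply: bexp_le => // t.
  by rewrite big_nil.
have {}IHW := IHW uW (fun a b aW bW =>
  Wmod a b (mem_behead (s := z :: W) aW) (mem_behead (s := z :: W) bW)).
pose G sigma := \prod_(z <- W) (1 + eR1 * (empty_rod m sigma z)%:R).
have G0 t : 0 <= G t.
  by apply: prodr_ge0 => v _; rewrite addr_ge0 // mulr_ge0.
have -> : bexp r s (fun sigma =>
     \prod_(z <- z :: W) (1 + eR1 * (empty_rod m sigma z)%:R)) (fun=> true) =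
   bexp r s G (fun=> true) + eR1 * bexp r s (fun t => (empty_rod m t z)%:R * G t) (fun=> true).
  by rewrite -bexpZ -bexpD; apply: bexp_ext => t; rewrite big_cons mulrDl mul1r mulrA.
rewrite [leRHS]exprS [leRHS]mulrDl mul1r; apply: lerD => //.
rewrite -mulrA; apply: ler_wpM2l => //.
apply: (@le_trans _ _ (r ^+ m * bexp r s G (fun=> true))); last first.
  by apply: ler_wpM2l => //; rewrite exprn_ge0.
rewrite -[X in r ^+ X](size_iota 0) -(size_map (rod_site i0 z)).
apply: bexp_empty => //.
  by rewrite map_inj_uniq ?iota_uniq //; exact: rod_site_inj.
move=> x xz t b; apply: eq_big_seq => v vW; congr (1 + _ * _%:R).
congr nat_of_bool; apply: eq_in_all => u uv; rewrite /upd; case: eqP => // ux.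
have zv : z = v.
  apply: (@rod_disjoint m _ _ x) => //; last by rewrite -ux.
  by apply: Wmod; rewrite inE ?eqxx ?vW ?orbT.
by rewrite zv vW in zW.
Qed.

Lemma expR_mean (m : nat) (Y : 'I_m -> R) : (0 < m)%N ->
  expR (m%:R^-1 * \sum_(i < m) Y i) <= m%:R^-1 * \sum_(i < m) expR (Y i).
Proof.
move=> m0; have mR : 0 < m%:R :> R by rewrite ltr0n.
set mu := m%:R^-1 * _.
have muE : \sum_(i < m) Y i = m%:R * mu by rewrite /mu mulrA divff ?mul1r // gt_eqF.
rewrite ler_pdivlMl //.
have -> : m%:R * expR mu = \sum_(i < m) expR mu * (1 + (Y i - mu)).
  rewrite -mulr_sumr big_split /= sumrB muE !big_const_ord !iter_addr_0 -[mu *+ m]mulr_natl.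
  by rewrite subrr addr0 mulrC.
apply: ler_sum => i _; rewrite -[X in _ <= expR X](subrKC mu) expRD.
by apply: ler_wpM2l; rewrite ?expR_ge0 // expR_ge1Dx.
Qed.

(* Rods whose base points agree modulo [m] in direction [i0] are disjoint, hence
   independent; convexity of exp reduces to one residue class. *)
Lemma bexp_expR_rods r s W (m : nat) : (0 < m)%N ->
  uniq s -> uniq W -> 0 <= r <= 1 ->
  bexp r s (fun sigma =>
      expR (m%:R^-1 * \sum_(z <- W) (empty_rod m sigma z)%:R)) (fun=> true)
  <= expR (eR1 * r ^+ m * (size W)%:R).
Proof.
move=> m0 us uW r01; case/andP: (r01) => r0 r1; have e0 := eR1_ge0.
have mR : 0 < m%:R :> R by rewrite ltr0n.
pose cls (i : 'I_m) z := modz (z 0 i0) m%:Z == i%:Z.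
have split_cls t : \sum_(z <- W) (empty_rod m t z)%:R =
    \sum_(i < m) \sum_(z <- [seq z <- W | cls i z]) (empty_rod m t z)%:R :> R.
  under [RHS]eq_bigr do rewrite big_filter big_mkcond /=.
  rewrite exchange_big /=; apply: eq_bigr => z _; rewrite -big_mkcond /=.
  have zm : (absz (modz (z ord0 i0) m%:Z) < m)%N.
    have := ltz_mod (z 0 i0) (_ : m%:Z != 0); have := modz_ge0 (z 0 i0) (_ : m%:Z != 0).
    have m0' : m%:Z != 0 by lia.
    by move=> /(_ m0') + /(_ m0'); move: (modz _ _) => k; lia.
  rewrite (bigD1 (Ordinal zm)) /=; last first.
    rewrite /cls /= gez0_abs //; apply: modz_ge0; lia.
  rewrite big1 ?addr0 // => i /andP[/eqP zi]; case/negP.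
  by apply/eqP/val_inj; rewrite /= zi.
have ptw t : expR (m%:R^-1 * \sum_(z <- W) (empty_rod m t z)%:R) <=
   m%:R^-1 * \sum_(i < m) \prod_(z <- [seq z <- W | cls i z]) (1 + eR1 * (empty_rod m t z)%:R).
  rewrite split_cls; apply: le_trans (expR_mean _ m0) _.
  rewrite ler_wpM2l ?invr_ge0 ?(ltW mR) //; apply: ler_sum => i _.
  rewrite expR_sum; apply: ler_prod => z _; rewrite expR_ge0 /=.
  case: (empty_rod _ _ _); rewrite ?mulr1 ?mulr0 ?addr0 ?expR0 //.
  by rewrite /eR1 subrKC.
apply: le_trans (bexp_le _ _ r01 ptw) _.
rewrite bexpZ bexp_sum ler_pdivrMl // mulr_natl -[X in _ *+ X]card_ord -sumr_const.
apply: ler_sum => i _; apply: le_trans (bexp_rods_class m0 us _ r01 _) _.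
- exact: filter_uniq.
- move=> z z'; rewrite !mem_filter => /andP[/eqP -> _] /andP[/eqP -> _] //.
have h1 : 1 <= 1 + eR1 * r ^+ m by rewrite lerDl mulr_ge0 ?exprn_ge0.
apply: (@le_trans _ _ ((1 + eR1 * r ^+ m) ^+ size W)).
  by apply: ler_weXn2l => //; rewrite size_filter count_size.
rewrite expRM_natr; apply: lerXn2r; rewrite ?nnegrE ?expR_ge0 ?(le_trans _ h1) //.
exact: expR_ge1Dx.
Qed.
End Rods.

(** * Union bound over coarse walks and choice of scales *)

Section Greedy.
Variables (R : realType) (d : nat) (i0 : 'I_d).
Implicit Types (x y z v : 'rV[int]_d) (sigma : 'rV[int]_d -> bool) (r : R).
Implicit Types (s W : seq 'rV[int]_d).

Lemma ler_sum_subset (T : eqType) (a b : seq T) (f : T -> R) :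
  uniq a -> uniq b -> {subset a <= b} -> (forall z : T, z \in b -> 0 <= f z) ->
  \sum_(z <- a) f z <= \sum_(z <- b) f z.
Proof.
move=> ua ub ab f0.
have pab : perm_eq a [seq z <- b | z \in a].
  apply: uniq_perm; [by []|exact: filter_uniq|move=> u].
  by rewrite mem_filter; case: (boolP (u \in a)) => //= /ab.
rewrite (perm_big _ pab) big_filter [leRHS](bigID (fun u => u \in a)) /= lerDl.
by rewrite big_seq_cond; apply: sumr_ge0 => u /andP[/f0].
Qed.

(* At scale [M] the walk is followed by one of [B ^ (2 * j)] coarse walks, where
   [j * M] is at most the number of visited sites; the union bound over the
   coarse walks is paid for by [t * j]. *)
Lemma bexp_empty_rods (N M m : nat) y x s r (t theta : R) :
  uniq s -> (forall p, p \in paths N y x -> {subset p <= s}) ->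
  (l1 (x - y) <= N)%N -> 0 <= r <= 1 -> (0 < M)%N -> (0 < m)%N ->
  0 <= t -> 0 <= theta < 1 ->
  expR (- t) * ((4 * M + 3) ^ d)%:R ^+ 2 *
    expR (2 * (eR1 R * r ^+ m * ((4 * M).+1 ^ d)%:R)) <= theta ->
  bexp r s (fun sigma =>
      \sum_(z <- s) hitprob R N y sigma x z * (empty_rod i0 m sigma z)%:R) (fun=> true)
  <= m%:R * (t / M%:R * bexp r s (fun sigma => mean_range R N y sigma x s) (fun=> true)
     + (expR (eR1 R * r ^+ m * ((4 * M).+1 ^ d)%:R) / (1 - theta) - 1)).
Proof.
have M43 : (2 * (2 * M).+1).+1 = (4 * M + 3)%N by lia.
move=> us ps xyN r01 M0 m0 t0 /andP[th0 th1] hth.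
have mR : 0 < m%:R :> R by rewrite ltr0n.
have MR : 0 < M%:R :> R by rewrite ltr0n.
case/andP: (r01) => r0 r1; have e0 := eR1_ge0 R.
pose B := box d (2 * M).+1.
pose Y sigma (v : seq 'rV[int]_d) : R := \sum_(z <- tube M v) (empty_rod i0 m sigma z)%:R.
(* If X counts the sites of a path with empty rods, then [expR (X / m - t * j)] is at most one of
   these nonnegative terms, the one of its coarse walk. With [1 + u <= expR u] the bound on X
   becomes affine in [Z1], so only the mean of [Z1] is needed. *)
pose Z1 sigma := \sum_(j < N.+1) expR (- (t * j%:R)) *
   \sum_(v <- cwalks B (2 * j) x) expR (m%:R^-1 * Y sigma v).
have ptw sigma p : p \in paths N y x ->
    \sum_(z <- undup p) (empty_rod i0 m sigma z)%:R <=
    m%:R * (t / M%:R * (size (undup p))%:R + (Z1 sigma - 1)).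
  move=> pp; have [j [v [jN vB pv jM]]] := path_tube M0 pp.
  have XY : \sum_(z <- undup p) (empty_rod i0 m sigma z)%:R <= Y sigma v.
    apply: ler_sum_subset; rewrite ?undup_uniq // => z.
    by rewrite mem_undup; exact: pv.
  rewrite -ler_pdivrMl //.
  have tj : t * j%:R <= t / M%:R * (size (undup p))%:R.
    rewrite -mulrA; apply: ler_wpM2l => //.
    by rewrite mulrC ler_pdivlMr // -natrM ler_nat.
  have : 1 + (m%:R^-1 * \sum_(z <- undup p) (empty_rod i0 m sigma z)%:R - t * j%:R) <= Z1 sigma.
    apply: le_trans (expR_ge1Dx _) _.
    apply: (@le_trans _ _ (expR (- (t * j%:R)) * expR (m%:R^-1 * Y sigma v))).
      by rewrite -expRD ler_expR addrC lerD2l ler_wpM2l // invr_ge0 ltW.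
    rewrite /Z1 (bigD1 (inord j)) //= inordK //.
    apply: (@le_trans _ _ (expR (- (t * j%:R)) *
        \sum_(v <- cwalks B (2 * j) x) expR (m%:R^-1 * Y sigma v))).
      apply: ler_wpM2l; first exact: expR_ge0.
      rewrite (big_rem v) //= lerDl; apply: sumr_ge0 => v' _; exact: expR_ge0.
    rewrite lerDl; apply: sumr_ge0 => k _; apply: mulr_ge0; first exact: expR_ge0.
    apply: sumr_ge0 => v' _; exact: expR_ge0.
  lra.
have ptw2 sigma : \sum_(z <- s) hitprob R N y sigma x z * (empty_rod i0 m sigma z)%:R
   <= m%:R * (t / M%:R) * mean_range R N y sigma x s + (m%:R * Z1 sigma - m%:R).
  have U0 := @psum_gt0 R d i0 N y sigma x xyN.
  rewrite (sum_hitprob sigma _ us ps) (mean_rangeE R sigma us ps).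
  rewrite ler_pdivrMr // mulrDl mulrA divfK ?gt_eqF //.
  rewrite /psum [X in _ <= X + _]mulr_sumr [X in _ <= _ + X]mulr_sumr.
  rewrite -big_split /= big_seq [leRHS]big_seq.
  apply: ler_sum => p pp; have W0 : 0 <= pweight (bweight R sigma) p.
    by apply: pweight_ge0; exact: bweight_ge0.
  apply: le_trans (ler_wpM2l W0 (ptw sigma p pp)) _.
  by rewrite le_eqVlt; apply/orP; left; apply/eqP; ring.
apply: le_trans (bexp_le _ _ r01 ptw2) _.
rewrite bexpD bexpZ bexpB bexpZ bexp_cst [leRHS]mulrDr [X in _ <= X + _]mulrA lerD2l.
rewrite [leRHS]mulrBr mulr1 lerD2r; apply: ler_wpM2l; first exact: ltW.
rewrite bexp_sum.
set E := expR (eR1 R * r ^+ m * _) in hth *.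
(* A coarse walk of [2 * j] steps has [2 * j + 1] points, so its tube costs one [E] and then
   [E ^+ 2] per unit of [j]; the walks number [(4 * M + 3) ^ d] to the power [2 * j]. This explains
   the factor 2 and the square in the condition on [theta]. *)
have Ej (j : 'I_N.+1) : bexp r s (fun sigma => expR (- (t * j%:R)) *
     \sum_(v <- cwalks B (2 * j) x) expR (m%:R^-1 * Y sigma v)) (fun=> true)
     <= E * theta ^+ j.
  rewrite bexpZ bexp_sum.
  apply: (@le_trans _ _ (expR (- (t * j%:R)) * \sum_(v <- cwalks B (2 * j) x)
      expR (eR1 R * r ^+ m * ((2 * j).+1 * (4 * M).+1 ^ d)%:R))).
    apply: ler_wpM2l; first exact: expR_ge0.
    rewrite big_seq [leRHS]big_seq; apply: ler_sum => v vB.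
    apply: le_trans (bexp_expR_rods i0 m0 us (undup_uniq _) r01) _.
    rewrite ler_expR; apply: ler_wpM2l; first by rewrite mulr_ge0 ?exprn_ge0.
    by rewrite ler_nat -(size_mem_cwalks vB) size_tube.
  rewrite big_const_seq count_predT iter_addr_0 size_cwalks size_box.
  rewrite M43 -[X in _ * X]mulr_natr.
  have -> : expR (eR1 R * r ^+ m * ((2 * j).+1 * (4 * M).+1 ^ d)%:R) =
     E * expR (2 * (eR1 R * r ^+ m * ((4 * M).+1 ^ d)%:R)) ^+ j.
    rewrite -expRM_natl -expRD; congr expR.
    by rewrite natrM -[(2 * j).+1]addn1 natrD natrM; ring.
  have -> : expR (- (t * j%:R)) = expR (- t) ^+ j by rewrite -mulNr expRM_natr.
  rewrite [X in _ * (_ * X)]natrX exprM.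
  rewrite [leLHS](_ : _ = E * (expR (- t) * ((4 * M + 3) ^ d)%:R ^+ 2 *
      expR (2 * (eR1 R * r ^+ m * ((4 * M).+1 ^ d)%:R))) ^+ j); last first.
    by rewrite !exprMn; ring.
  apply: ler_wpM2l; first exact: expR_ge0.
  apply: lerXn2r; [|exact: th0|exact: hth].
  by rewrite nnegrE mulr_ge0 ?expR_ge0 // mulr_ge0 ?expR_ge0 ?exprn_ge0.
apply: le_trans (ler_sum _ (fun j _ => Ej j)) _.
rewrite -mulr_sumr; apply: ler_wpM2l; first exact: expR_ge0.
rewrite -[leRHS]mul1r ler_pdivlMr ?subr_gt0 //.
have -> : (\sum_(i < N.+1) theta ^+ i) * (1 - theta) = 1 - theta ^+ N.+1.
  by rewrite mulrC -[RHS]opprB subrX1 -mulNr opprB.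
by rewrite gerBl exprn_ge0.
Qed.

Lemma ler_bernoulli (a : R) m : 1 <= a -> 1 + m%:R * (a - 1) <= a ^+ m.
Proof.
move=> a1; elim: m => [|m IHm]; first by rewrite mul0r addr0 expr0.
have am : 1 <= a ^+ m by apply: exprn_ege1.
rewrite exprS -natr1.
have : (a - 1) * 1 <= (a - 1) * a ^+ m by apply: ler_wpM2l; rewrite ?subr_ge0.
lra.
Qed.

Lemma ler_geom (a : R) N : 1 < a -> \sum_(1 <= m < N.+1) a^-1 ^+ m <= (a - 1)^-1.
Proof.
move=> a1; have a0 : 0 < a by exact: lt_trans a1.
have am1 : 0 < a - 1 by rewrite subr_gt0.
rewrite -[leRHS]mul1r ler_pdivlMr //.
suff -> : (\sum_(1 <= m < N.+1) a^-1 ^+ m) * (a - 1) = 1 - a^-1 ^+ N.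
  by rewrite gerBl exprn_ge0 // invr_ge0 ltW.
elim: N => [|N IHN]; first by rewrite big_geq // mul0r expr0 subrr.
rewrite big_nat_recr //= mulrDl IHN exprS.
have -> : a^-1 * a^-1 ^+ N * (a - 1) = a^-1 ^+ N - a^-1 * a^-1 ^+ N.
  by field; rewrite gt_eqF.
by rewrite addrA subrK.
Qed.

Lemma nat_between (t : R) : 1 <= t -> exists2 M : nat, t <= M%:R & M%:R <= 2 * t.
Proof.
move=> t1; have t0 : 0 <= t by exact: le_trans t1.
exists (Num.truncn t).+1; first by rewrite ltW // truncnS_gt.
rewrite -natr1 mulr_natl mulr2n lerD //.
by rewrite truncn_le.
Qed.

(** For rods of length m take M between a^(4m) and 2 a^(4m), t = m T and theta = h / 2, where h =
    a^(-4m). In the condition on r, the exponent 4d pays for the tube volume, of order M^d, and the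
    remaining 4 leaves the factor h. In the sum over m, h pays for the weight a^m and for m^2 <=
    a^(2m) / (a - 1)^2, and a geometric series of ratio 1/a remains. *)
Lemma bexp_rod_len (a : R) : 1 < a -> exists2 C : R, 0 <= C &
  forall r N y x s, uniq s -> (forall p, p \in paths N y x -> {subset p <= s}) ->
  (l1 (x - y) <= N)%N -> 0 <= r <= 1 -> a ^+ (4 * d.+1) * r <= 1 ->
  bexp r s (fun sigma =>
     \sum_(z <- s) hitprob R N y sigma x z * a ^+ rod_len i0 N sigma z) (fun=> true)
  <= C * (1 + bexp r s (fun sigma => mean_range R N y sigma x s) (fun=> true)).
Proof.
move=> a1; have a0 : 0 < a by exact: lt_trans a1.
have a1' : 1 <= a by exact: ltW.
have e0 := eR1_ge0 R.
(* The numbers 9 and 11 come from 4M + 1 <= 9 a^(4m) and 4M + 3 <= 11 a^(4m). The 2 in [D2] is the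
   one in theta = h / 2, and [T] makes expR (- m T) absorb the entropy a^(8dm) and a further
   a^(4m). *)
pose D1 := eR1 R * 9 ^+ d.
have D10 : 0 <= D1 by rewrite mulr_ge0 ?exprn_ge0.
pose D2 := 2 * 11 ^+ (2 * d) * expR (2 * D1).
have D20 : 0 < D2 by rewrite mulr_gt0 ?expR_gt0 // mulr_gt0 ?exprn_gt0.
have D21 : 1 <= D2.
  have h1 : 1 <= 11 ^+ (2 * d) :> R by apply: exprn_ege1; rewrite ler1n.
  have h2 : 1 <= expR (2 * D1) by rewrite -expR0 ler_expR mulr_ge0.
  have h3 : 1 <= 2 :> R by rewrite ler1n.
  by rewrite -[leLHS]mulr1 ler_pM // -[leLHS]mulr1 ler_pM.
pose T := ln (D2 * a ^+ (8 * d + 4)).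
have aD2 : 1 <= D2 * a ^+ (8 * d + 4).
  by rewrite -[leLHS]mulr1 ler_pM // exprn_ege1.
have T0 : 0 <= T by exact: ln_ge0.
have eT : expR T = D2 * a ^+ (8 * d + 4) by rewrite /T lnK // posrE (lt_le_trans ltr01).
pose C1 := T + (2 * (D1 * expR D1) + 1).
have C10 : 0 <= C1.
  by rewrite addr_ge0 // addr_ge0 // mulr_ge0 // mulr_ge0 ?expR_ge0.
pose C := a * (1 + C1 * (a - 1)^-1 ^+ 3).
exists C.
  rewrite mulr_ge0 ?(ltW a0) // addr_ge0 // mulr_ge0 // exprn_ge0 // invr_ge0.
  by rewrite subr_ge0.
move=> r N y x s us ps xyN r01 ar; case/andP: (r01) => r0 r1.
set EM := bexp r s (fun sigma => mean_range R N y sigma x s) _.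
have EM0 : 0 <= EM.
  by apply: bexp_ge0 => // t; apply: sumr_ge0 => z _; exact: hitprob_ge0.
have scale m : (0 < m)%N -> bexp r s (fun sigma =>
      \sum_(z <- s) hitprob R N y sigma x z * (empty_rod i0 m sigma z)%:R) (fun=> true)
    <= C1 * (m%:R ^+ 2 * (a^-1 ^+ (4 * m)) * (1 + EM)).
  move=> m0; have mR : 1 <= m%:R :> R by rewrite ler1n.
  have am1 : 1 <= a ^+ (4 * m) by exact: exprn_ege1.
  have am0 : 0 < a ^+ (4 * m) by exact: exprn_gt0.
  set h := a^-1 ^+ (4 * m).
  have hE : h = (a ^+ (4 * m))^-1 by rewrite /h exprVn.
  have h0 : 0 < h by rewrite hE invr_gt0.
  have h1 : h <= 1 by rewrite hE invf_le1.
  have [M aM Ma] := nat_between am1.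
  have M0 : (0 < M)%N by rewrite -(ltr_nat R); exact: lt_le_trans aM.
  have M1 : 1 <= M%:R :> R by rewrite ler1n.
  have rK : r ^+ m * ((4 * M).+1 ^ d)%:R <= 9 ^+ d * h.
    apply: (@le_trans _ _ (r ^+ m * (9 * a ^+ (4 * m)) ^+ d)).
      apply: ler_wpM2l; first by rewrite exprn_ge0.
      rewrite natrX; apply: lerXn2r; rewrite ?nnegrE ?ler0n ?mulr_ge0 ?(ltW am0) //.
      by rewrite -addn1 natrD natrM; move: Ma am1; set A := a ^+ _; lra.
    rewrite exprMn mulrCA; apply: ler_wpM2l; first by rewrite exprn_ge0.
    rewrite hE -[leRHS]mul1r ler_pdivlMr // -mulrA -exprSr.
    rewrite -exprM -mulnA [(m * _)%N]mulnC mulnA exprM -exprMn mulrC.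
    by apply: exprn_ile1; rewrite // mulr_ge0 // exprn_ge0 // ltW.
  have eK : eR1 R * r ^+ m * ((4 * M).+1 ^ d)%:R <= D1 * h.
    by rewrite -mulrA -mulrA; apply: ler_wpM2l.
  have eK0 : 0 <= eR1 R * r ^+ m * ((4 * M).+1 ^ d)%:R.
    by rewrite mulr_ge0 // mulr_ge0 // exprn_ge0.
  have D1h : D1 * h <= D1 by rewrite ler_piMr.
  have mT0 : 0 <= m%:R * T by rewrite mulr_ge0.
  have th : 0 <= h / 2 < 1.
    by apply/andP; split; [rewrite divr_ge0 // ltW | lra].
  apply: le_trans (@bexp_empty_rods N M m y x s r (m%:R * T) (h / 2)
    us ps xyN r01 M0 m0 mT0 th _) _.
    have s1 : ((4 * M + 3) ^ d)%:R ^+ 2 <= 11 ^+ (2 * d) * a ^+ (8 * d * m) :> R.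
      have -> : 11 ^+ (2 * d) * a ^+ (8 * d * m) = ((11 * a ^+ (4 * m)) ^+ d) ^+ 2 :> R.
        rewrite -!exprM exprMn -!exprM; congr (_ ^+ _ * _ ^+ _); first exact: mulnC.
        by clear; lia.
      rewrite natrX; apply: lerXn2r; rewrite ?nnegrE ?exprn_ge0 ?mulr_ge0 ?(ltW am0) //.
      apply: lerXn2r; rewrite ?nnegrE ?mulr_ge0 ?(ltW am0) //.
      by rewrite natrD natrM; move: Ma am1; set A := a ^+ _; lra.
    have s2 : expR (2 * (eR1 R * r ^+ m * ((4 * M).+1 ^ d)%:R)) <= expR (2 * D1).
      by rewrite ler_expR ler_wpM2l // (le_trans eK).
    have s3 : expR (- (m%:R * T)) <= (D2 * a ^+ (8 * d * m) * a ^+ (4 * m))^-1.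
      have P : 0 < D2 * a ^+ (8 * d * m) * a ^+ (4 * m).
        by apply: mulr_gt0 => //; apply: mulr_gt0 => //; exact: exprn_gt0.
      rewrite expRN expRM_natl eT lef_pV2 ?posrE //; last first.
        by apply: exprn_gt0; apply: mulr_gt0 => //; exact: exprn_gt0.
      rewrite exprMn -exprM mulnDl exprD mulrA.
      by rewrite !ler_wpM2r ?exprn_ge0 ?(ltW a0) // ler_eXnr.
    apply: (@le_trans _ _ ((D2 * a ^+ (8 * d * m) * a ^+ (4 * m))^-1 *
        (11 ^+ (2 * d) * a ^+ (8 * d * m)) * expR (2 * D1))).
      apply: ler_pM => //; rewrite ?expR_ge0 ?mulr_ge0 ?exprn_ge0 ?expR_ge0 //.
      by apply: ler_pM => //; rewrite ?expR_ge0 ?exprn_ge0.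
    rewrite le_eqVlt; apply/orP; left; apply/eqP; rewrite hE /D2.
    by field; rewrite !gt_eqF ?expR_gt0 ?exprn_gt0.
  have p1 : m%:R * T / M%:R * EM <= m%:R * T * h * EM.
    apply: ler_wpM2r => //; apply: ler_wpM2l => //.
    by rewrite hE lef_pV2 ?posrE // (lt_le_trans ltr01).
  have p2 : expR (eR1 R * r ^+ m * ((4 * M).+1 ^ d)%:R) <= 1 + D1 * expR D1 * h.
    apply: (@le_trans _ _ (expR (D1 * h))); first by rewrite ler_expR.
    have := expR_ge1Dx (- (D1 * h)); rewrite expRN => q1.
    have q2 : expR (D1 * h) <= expR D1 by rewrite ler_expR.
    have q3 : (1 + - (D1 * h)) * expR (D1 * h) <= 1.
      by rewrite -[leRHS](@mulVf _ (expR (D1 * h))) ?gt_eqF ?expR_gt0 // ler_wpM2r ?expR_ge0.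
    have q4 : D1 * h * expR (D1 * h) <= D1 * h * expR D1.
      by rewrite ler_wpM2l // mulr_ge0 // ltW.
    lra.
  have p3 : (1 - h / 2)^-1 <= 1 + h.
    rewrite -[leLHS]mul1r ler_pdivrMr; last by lra.
    have : h * h <= h * 1 by rewrite ler_wpM2l // ltW.
    lra.
  have p4 : expR (eR1 R * r ^+ m * ((4 * M).+1 ^ d)%:R) / (1 - h / 2) - 1 <=
      (2 * (D1 * expR D1) + 1) * h.
    have := ler_pM (expR_ge0 _) _ p2 p3; rewrite invr_ge0 => /(_ _)/le_trans q.
    rewrite lerBlDr; apply: q; first by lra.
    set G := D1 * expR D1.
    have G0 : 0 <= G by rewrite mulr_ge0 ?expR_ge0.
    have : G * h * h <= G * h * 1 by rewrite ler_wpM2l // mulr_ge0 // ltW.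
    lra.
  set G := 2 * (D1 * expR D1) + 1 in p4 *.
  have G0 : 0 <= G by rewrite addr_ge0 // mulr_ge0 // mulr_ge0 ?expR_ge0.
  apply: (@le_trans _ _ (m%:R * (m%:R * T * h * EM + G * h))).
    by apply: ler_wpM2l; [exact: le_trans mR|exact: lerD].
  have m2 : m%:R <= m%:R ^+ 2 :> R by rewrite expr2 ler_peMr // (le_trans _ mR).
  apply: (@le_trans _ _
    (T * (m%:R ^+ 2 * h * (1 + EM)) + G * (m%:R ^+ 2 * h * (1 + EM)))); last first.
    by rewrite -mulrDl -/C1.
  rewrite mulrDr; apply: lerD.
    rewrite [leLHS](_ : _ = T * (m%:R ^+ 2 * h * EM)); last by ring.
    apply: ler_wpM2l => //; apply: ler_wpM2l; last by rewrite lerDr.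
    by apply: mulr_ge0; [exact: exprn_ge0|exact: ltW].
  rewrite mulrCA; apply: ler_wpM2l => //.
  rewrite -[leLHS]mulr1; apply: ler_pM => //; last by rewrite lerDl.
    by rewrite mulr_ge0 // ltW.
  by apply: ler_wpM2r => //; exact: ltW.
apply: (@le_trans _ _ (bexp r s (fun sigma => a * mean_range R N y sigma x s +
   \sum_(1 <= m < N.+1) a ^+ m.+1 *
     \sum_(z <- s) hitprob R N y sigma x z * (empty_rod i0 m sigma z)%:R) (fun=> true))).
  apply: bexp_le => // t.
  rewrite /mean_range mulr_sumr.
  under [X in _ <= _ + X]eq_bigr do rewrite mulr_sumr.
  rewrite [X in _ <= _ + X]exchange_big -big_split /=; apply: ler_sum => z _.
  apply: le_trans (ler_wpM2l (hitprob_ge0 _ N y t x z) (expr_rod_len i0 N t z a1')) _.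
  rewrite mulrDr [hitprob _ _ _ _ _ _ * a]mulrC lerD2l mulr_sumr.
  by apply: ler_sum => m _; rewrite mulrCA.
rewrite bexpD bexpZ -/EM bexp_sum.
apply: (@le_trans _ _ (a * (1 + EM) +
  \sum_(1 <= m < N.+1) a * C1 * (a - 1)^-1 ^+ 2 * (1 + EM) * a^-1 ^+ m)).
  apply: lerD; first by apply: ler_wpM2l; [exact: ltW|rewrite lerDr].
  rewrite big_nat [leRHS]big_nat; apply: ler_sum => m /andP[m0 _].
  rewrite bexpZ; apply: le_trans (ler_wpM2l _ (scale m m0)) _.
    by rewrite exprn_ge0 // ltW.
  have mb : m%:R ^+ 2 <= (a - 1)^-1 ^+ 2 * a ^+ (2 * m).
    rewrite mulnC exprM -exprMn; apply: lerXn2r; rewrite ?nnegrE ?ler0n //.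
      by rewrite mulr_ge0 ?invr_ge0 ?subr_ge0 // exprn_ge0 // ltW.
    rewrite mulrC ler_pdivlMr ?subr_gt0 //.
    by apply: le_trans (ler_bernoulli m a1'); rewrite lerDr.
  apply: (@le_trans _ _ (a ^+ m.+1 *
    (C1 * ((a - 1)^-1 ^+ 2 * a ^+ (2 * m) * a^-1 ^+ (4 * m) * (1 + EM))))).
    apply: ler_wpM2l; first by rewrite exprn_ge0 // ltW.
    apply: ler_wpM2l => //; apply: ler_wpM2r; first by rewrite addr_ge0.
    by apply: ler_wpM2r => //; rewrite exprn_ge0 // invr_ge0 ltW.
  have -> : (4 * m = 2 * m + m + m)%N by clear; lia.
  rewrite !exprD exprVn exprS (exprVn _ m) le_eqVlt; apply/orP; left; apply/eqP.
  by field; rewrite !gt_eqF ?exprn_gt0 ?subr_gt0.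
rewrite -mulr_sumr.
apply: (@le_trans _ _ (a * (1 + EM) + a * C1 * (a - 1)^-1 ^+ 2 * (1 + EM) * (a - 1)^-1)).
  rewrite lerD2l; apply: ler_wpM2l; last exact: ler_geom.
  have q0 : 0 <= (a - 1)^-1 by rewrite invr_ge0 subr_ge0.
  apply: mulr_ge0; last by rewrite addr_ge0.
  by apply: mulr_ge0; [apply: mulr_ge0; [exact: ltW|exact: C10]|exact: exprn_ge0].
by rewrite le_eqVlt; apply/orP; left; apply/eqP; rewrite /C; set q := _^-1; ring.
Qed.

End Greedy.

(** * Finite-volume estimates *)

Section FiniteVolume.
Variables (R : realType) (d : nat) (i0 : 'I_d).
Implicit Types (x y z v : 'rV[int]_d) (sigma : 'rV[int]_d -> bool) (r : R).

Definition sites (N : nat) y x : seq 'rV[int]_d := undup (flatten (paths N y x)).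

Lemma uniq_sites N y x : uniq (sites N y x).
Proof. exact: undup_uniq. Qed.

Lemma sub_sites N y x p : p \in paths N y x -> {subset p <= sites N y x}.
Proof. by move=> pp z zp; rewrite mem_undup; apply/flattenP; exists p. Qed.

Lemma sites_neq N y x z : z \in sites N y x -> z != y.
Proof.
rewrite mem_undup => /flattenP[p /mem_paths[_ yp _] zp].
by apply: contraNneq yp => <-.
Qed.

(** The cost reads the configuration on [sites] only; the obstacles outside end the rods that leave
    [sites]. *)
Definition mean_cost N y x r : R :=
  bexp r (sites N y x) (fun sigma => cost R N y sigma x) (fun=> true).

Lemma mean_cost_diff_ge N y x (p q : R) : (l1 (x - y) <= N)%N ->
  0 <= p -> p < q -> q <= 1 ->
  (1 - expR (-1)) * (q - p) * (l1 (x - y))%:R <=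
  mean_cost N y x p - mean_cost N y x q.
Proof.
move=> xyN p0 pq q1; rewrite /mean_cost.
have [c /andP[pc cq] ->] := bexp_mvt (fun sigma => cost R N y sigma x)
   (fun=> true) (uniq_sites N y x) pq.
have c01 : 0 <= c <= 1.
  by rewrite (le_trans p0 (ltW pc)) (le_trans (ltW cq) q1).
rewrite [X in X * _]mulrC -mulrA; apply: ler_wpM2l; first by rewrite subr_ge0 ltW.
apply: (@le_trans _ _ ((1 - expR (-1)) * bexp c (sites N y x)
   (fun sigma => mean_range R N y sigma x (sites N y x)) (fun=> true))).
  apply: ler_wpM2l; first by rewrite subr_ge0 ltW // expRN1_lt1.
  rewrite -[leLHS](bexp_cst c (sites N y x) _ (fun=> true)); apply: bexp_le => // t.
  by apply: (mean_range_ge R i0) => //; [exact: uniq_sites|exact: sub_sites].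
rewrite -bexpZ -bexp_sum; apply: bexp_le => // t.
rewrite /mean_range mulr_sumr big_seq [leRHS]big_seq; apply: ler_sum => z zs.
by apply: (cost_flip_ge R i0) => //; exact: sites_neq zs.
Qed.

Lemma kappaE N sigma z : expR 1 / kappa R i0 N sigma z =
  expR 1 / (1 - expR (-1)) * (2 * d)%:R ^+ rod_len i0 N sigma z.
Proof. by rewrite /kappa invfM -exprVn invrK mulrA. Qed.

Lemma rod_len_upd N sigma z b : rod_len i0 N (upd sigma z b) z = rod_len i0 N sigma z.
Proof.
congr (_.+1); apply: eq_find => j; rewrite /upd.
by rewrite (negPf (rod_site_neq _ _ _)).
Qed.

Lemma flip_bound_small r N y x : (l1 (x - y) <= N)%N -> 0 <= r <= 1 ->
  \sum_(z <- sites N y x) bexp r (sites N y x)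
     (flipdiff (fun sigma => cost R N y sigma x) z) (fun=> true) <=
  expR 1 / (1 - expR (-1)) * bexp r (sites N y x) (fun sigma =>
    \sum_(z <- sites N y x) hitprob R N y sigma x z * (2 * d)%:R ^+ rod_len i0 N sigma z)
    (fun=> true).
Proof.
move=> xyN r01; rewrite -bexpZ -bexp_sum; apply: bexp_le => // t.
rewrite mulr_sumr big_seq [leRHS]big_seq; apply: ler_sum => z zs.
apply: le_trans (cost_flip_le R i0 t (sites_neq zs) xyN) _.
by rewrite kappaE mulrAC mulrA.
Qed.

(** The logarithmic bound involves the emptied site; [bexp_site_le] returns to the actual
    configuration at the price [r^-1 <= r0^-1], emptying [z] having left its rod length
    unchanged. *)
Lemma flip_bound_large r (r0 C4 a : R) N y x : (l1 (x - y) <= N)%N ->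
  0 < r0 -> r0 <= r -> r <= 1 ->
  (forall k, ln (expR 1 / (1 - expR (-1)) * (2 * d)%:R ^+ k.+1) <= C4 * a ^+ k.+1) ->
  \sum_(z <- sites N y x) bexp r (sites N y x)
     (flipdiff (fun sigma => cost R N y sigma x) z) (fun=> true) <=
  r0^-1 * (C4 * bexp r (sites N y x) (fun sigma =>
    \sum_(z <- sites N y x) hitprob R N y sigma x z * a ^+ rod_len i0 N sigma z)
    (fun=> true)).
Proof.
move=> xyN r00 r0r r1 lnle; have rgt0 := lt_le_trans r00 r0r.
have r01 : 0 <= r <= 1 by rewrite ltW.
rewrite -bexpZ.
pose G z sigma : R := ln (expR 1 / kappa R i0 N sigma z) * hitprob R N y sigma x z.
have G0 z t : 0 <= G z t.
  rewrite mulr_ge0 ?hitprob_ge0 // ln_ge0 // kappaE.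
  have e0 := expR_gt0 (-1 : R); have e1 := expRN1_lt1 R; have e2 := expR_ge1Dx (1 : R).
  rewrite -[leLHS]mulr1; apply: ler_pM => //.
    by rewrite ler_pdivlMr; lra.
  by apply: exprn_ege1; rewrite ler1n muln_gt0 (dim_gt0 i0).
apply: (@le_trans _ _
  (\sum_(z <- sites N y x) r0^-1 * bexp r (sites N y x) (G z) (fun=> true))).
  rewrite big_seq [leRHS]big_seq; apply: ler_sum => z zs.
  apply: (@le_trans _ _ (r^-1 * bexp r (sites N y x) (G z) (fun=> true))); last first.
    apply: ler_wpM2r; first exact: bexp_ge0.
    by rewrite lef_pV2 ?posrE.
  rewrite ler_pdivlMl //.
  apply: le_trans (bexp_site_le _ (uniq_sites N y x) zs r01 (G0 z)).
  apply: ler_wpM2l; first exact: ltW.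
  apply: bexp_le => // t; rewrite /G /kappa rod_len_upd -/(kappa R i0 N t z).
  exact: (cost_flip_le_ln R i0 t (sites_neq zs) xyN).
rewrite -mulr_sumr; apply: ler_wpM2l; first by rewrite invr_ge0 ltW.
rewrite -bexp_sum; apply: bexp_le => // t; rewrite mulr_sumr.
apply: ler_sum => z _; rewrite /G [leRHS]mulrCA [leLHS]mulrC.
apply: ler_wpM2l; first exact: hitprob_ge0.
by rewrite kappaE; exact: lnle.
Qed.

Lemma mean_range_linear (q0 : R) : 0 < q0 < 1 -> exists2 L : R, 0 <= L &
  forall r N y x, (l1 (x - y) <= N)%N -> 0 <= r <= q0 ->
  bexp r (sites N y x) (fun sigma => mean_range R N y sigma x (sites N y x)) (fun=> true)
  <= L * (l1 (x - y))%:R.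
Proof.
move=> /andP[q00 q01]; have e0 := expR_gt0 (-1 : R); have e1 := expRN1_lt1 R.
(* Mean weight of a site at the largest admissible parameter; with [lam = - ln v] the condition of
   [bexp_mean_range] is an equality at [r = q0]. *)
pose v := q0 + (1 - q0) * expR (-1).
have v0 : 0 < v by rewrite addr_gt0 // mulr_gt0 // subr_gt0.
have v1 : v < 1.
  have : (1 - q0) * expR (-1) < (1 - q0) * 1 by rewrite ltr_pM2l // subr_gt0.
  rewrite /v; lra.
have lnv : 0 < - ln v by rewrite oppr_gt0 ln_lt0 // v0.
have d0 := dim_gt0 i0.
have l2d : 0 <= 1 + ln (2 * d)%:R :> R by rewrite addr_ge0 // ln_ge0 // ler1n muln_gt0.
exists ((1 + ln (2 * d)%:R) / - ln v); first by rewrite divr_ge0 // ltW.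
move=> r N y x xyN /andP[r0 rq].
rewrite mulrAC ler_pdivlMr // mulrC.
apply: le_trans (bexp_mean_range i0 _ (uniq_sites N y x) _ xyN _ (ltW lnv) _) _.
- exact: sub_sites.
- by rewrite r0 (le_trans rq (ltW q01)).
- rewrite expRN lnK ?posrE // ler_pdivrMl // mulr1 /v.
  have : (q0 - r) * expR (-1) <= (q0 - r) * 1 by rewrite ler_wpM2l ?subr_ge0 // ltW.
  lra.
by rewrite mulrC.
Qed.

Lemma mean_cost_diff_le (q0 : R) : 0 < q0 < 1 -> exists2 C : R, 0 < C &
  forall (p q : R) N y x, (l1 (x - y) <= N)%N -> 0 < p -> p < q -> q <= q0 ->
  mean_cost N y x p - mean_cost N y x q <= C * (q - p) * (1 + (l1 (x - y))%:R).
Proof.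
move=> q0b; case/andP: (q0b) => q00 q01; have d0 := dim_gt0 i0.
have [L L0 HL] := mean_range_linear q0b.
have e0 := expR_gt0 (-1 : R); have e1 := expRN1_lt1 R; have e2 := expR_gt0 (1 : R).
have d2 : 1 < (2 * d)%:R :> R by rewrite ltr1n; case: (d) d0 => // k _; rewrite mulnS.
have d20 : 0 < (2 * d)%:R :> R by exact: lt_trans d2.
have [C1 C10 H1] := bexp_rod_len i0 d2.
(* The largest base for which [bexp_rod_len] applies to all parameters up to [q0]. *)
pose a : R := expR (- ln q0 / (4 * d.+1)%:R).
have lnq : ln q0 < 0 by rewrite ln_lt0 // q00.
have a1 : 1 < a by rewrite expR_gt1 divr_gt0 ?oppr_gt0 // ltr0n.
have aq : a ^+ (4 * d.+1) = q0^-1.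
  by rewrite -expRM_natl mulrC divfK ?pnatr_eq0 // expRN lnK.
have [C2 C20 H2] := bexp_rod_len i0 a1.
pose C3 : R := expR 1 / (1 - expR (-1)).
have C31 : 1 <= C3.
  by rewrite ler_pdivlMr; have := expR_ge1Dx (1 : R); lra.
have C30 : 0 < C3 by exact: lt_le_trans C31.
(* By Bernoulli's inequality [k <= a ^+ k / (a - 1)], which turns linear growth in the rod length
   into powers of [a]. *)
pose C4 : R := ln C3 + ln (2 * d)%:R / (a - 1).
have ln2d : 0 <= ln (2 * d)%:R :> R by rewrite ln_ge0 // ltW.
have C40 : 0 <= C4 by rewrite addr_ge0 ?ln_ge0 // divr_ge0 // subr_ge0 ltW.
have lnle k : ln (C3 * (2 * d)%:R ^+ k.+1) <= C4 * a ^+ k.+1.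
  rewrite lnM ?posrE ?exprn_gt0 // lnXn // mulrDl; apply: lerD.
    by apply: ler_peMr; [exact: ln_ge0|apply: exprn_ege1; exact: ltW].
  rewrite -mulrA -[leLHS]mulr_natr; apply: ler_wpM2l => //.
  rewrite ler_pdivlMl ?subr_gt0 // mulrC.
  by apply: le_trans (ler_bernoulli _ (ltW a1)); rewrite lerDr.
(* Up to this parameter the base [2 * d] is admissible in [bexp_rod_len]. *)
pose r0 : R := (2 * d)%:R ^- (4 * d.+1).
have r00 : 0 < r0 by rewrite invr_gt0 exprn_gt0.
pose C5 := C3 * C1 + r0^-1 * (C4 * C2).
have C50 : 0 <= C5.
  apply: addr_ge0; first by rewrite mulr_ge0 // ltW.
  by apply: mulr_ge0; [rewrite invr_ge0 ltW|rewrite mulr_ge0].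
exists (C5 * (1 + L) + 1).
  by rewrite ltr_wpDl // mulr_ge0 // addr_ge0.
move=> p q N y x xyN p0 pq qq0; rewrite /mean_cost.
have [c /andP[pc cq] ->] := bexp_mvt (fun sigma => cost R N y sigma x)
   (fun=> true) (uniq_sites N y x) pq.
have c0 := lt_trans p0 pc; have cq0 := le_trans (ltW cq) qq0.
have c1 : c <= 1 by exact: le_trans (ltW q01).
have c01 : 0 <= c <= 1 by rewrite ltW.
rewrite [X in _ <= X * _]mulrC -mulrA; apply: ler_wpM2l; first by rewrite subr_ge0 ltW.
set E := bexp c (sites N y x) (fun sigma => mean_range R N y sigma x (sites N y x)) (fun=> true).
have E0 : 0 <= E.
  by apply: bexp_ge0 => // t; apply: sumr_ge0 => z _; exact: hitprob_ge0.
have EL : E <= L * (l1 (x - y))%:R by apply: HL => //; rewrite ltW.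
apply: (@le_trans _ _ (C5 * (1 + E))); last first.
  have l0 : 0 <= (l1 (x - y))%:R :> R by [].
  apply: (@le_trans _ _ (C5 * ((1 + L) * (1 + (l1 (x - y))%:R)))).
    by apply: ler_wpM2l => //; nra.
  by rewrite mulrA; apply: ler_wpM2r; [exact: addr_ge0|rewrite lerDl].
have [cr|rc] := leP c r0.
- apply: le_trans (flip_bound_small xyN c01) _.
  apply: (@le_trans _ _ (C3 * (C1 * (1 + E)))).
    apply: ler_wpM2l; first exact: ltW.
    apply: H1 => //; [exact: uniq_sites|exact: sub_sites|].
    by rewrite -ler_pdivlMl ?exprn_gt0 // mulr1.
  rewrite mulrA; apply: ler_wpM2r; first exact: addr_ge0.
  by rewrite lerDl mulr_ge0 ?invr_ge0 ?(ltW r00) // mulr_ge0.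
- apply: le_trans (flip_bound_large xyN r00 (ltW rc) c1 lnle) _.
  apply: (@le_trans _ _ (r0^-1 * (C4 * (C2 * (1 + E))))).
    apply: ler_wpM2l; first by rewrite invr_ge0 ltW.
    apply: ler_wpM2l => //.
    apply: H2 => //; [exact: uniq_sites|exact: sub_sites|].
    by rewrite aq ler_pdivrMl // mulr1.
  rewrite !mulrA; apply: ler_wpM2r; first exact: addr_ge0.
  by rewrite -mulrA lerDr mulr_ge0 // ltW.
Qed.

End FiniteVolume.

(** * Comparison of norms on the integer lattice *)

Section Norms.
Variables (R : realType) (d : nat).
Implicit Types (N : 'rV[R]_d -> R) (x y : 'rV[R]_d).

Lemma is_normN N x : is_norm N -> N (- x) = N x.
Proof. by move=> nN; rewrite -scaleN1r (is_norm_homogeneous nN) normrN1 mul1r. Qed.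

Lemma is_norm0 N : is_norm N -> N 0 = 0.
Proof. by move=> nN; rewrite -(scale0r 0) (is_norm_homogeneous nN) normr0 mul0r. Qed.

Lemma is_norm_sum N (I : Type) (s : seq I) (f : I -> 'rV[R]_d) : is_norm N ->
  N (\sum_(i <- s) f i) <= \sum_(i <- s) N (f i).
Proof.
move=> nN; elim: s => [|i s IHs]; first by rewrite !big_nil is_norm0.
by rewrite !big_cons; apply: le_trans (is_norm_triangle nN _ _) _; rewrite lerD2l.
Qed.

Lemma is_norm_ge0 N x : is_norm N -> 0 <= N x.
Proof.
move=> nN; have := is_norm_triangle nN x (- x).
by rewrite subrr is_norm0 // is_normN //; lra.
Qed.

Lemma is_norm_lip N x y : is_norm N ->
  (forall i, `|(x - y) 0 i| <= 1) -> N x <= N y + \sum_(i < d) N (delta_mx 0 i).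
Proof.
move=> nN xy; have -> : x = y + (x - y) by rewrite subrKC.
apply: le_trans (is_norm_triangle nN _ _) _; rewrite lerD2l.
rewrite {1}[x - y]row_sum_delta; apply: le_trans (is_norm_sum _ _ nN) _.
apply: ler_sum => i _; rewrite (is_norm_homogeneous nN) ler_piMl //.
exact: is_norm_ge0.
Qed.

Lemma l1norm_is_norm : is_norm (@l1norm R d).
Proof.
split.
- by move=> x y; rewrite /l1norm -big_split /=; apply: ler_sum => i _; rewrite mxE ler_normD.
- by move=> c x; rewrite /l1norm mulr_sumr; apply: eq_bigr => i _; rewrite mxE normrM.
- move=> x /eqP; rewrite psumr_eq0; last by move=> i _.
  move=> /allP x0; apply/rowP => i; rewrite mxE; apply/eqP.
  by have := x0 i; rewrite mem_index_enum normr_eq0 => /(_ isT).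
Qed.

Lemma l1norm_intr (z : 'rV[int]_d) : l1norm (map_mx intr z : 'rV[R]_d) = (l1 z)%:R.
Proof.
rewrite /l1norm /l1 natr_sum; apply: eq_bigr => i _.
by rewrite mxE -intr_norm -abszE.
Qed.

Lemma archimedean_ge0 (h K : R) : (forall k : nat, (0 < k)%N -> - K <= k%:R * h) -> 0 <= h.
Proof.
move=> H; rewrite leNgt; apply/negP => h0.
pose k := (Num.truncn (`|K| / - h)).+1.
have := H k isT; apply/negP; rewrite -ltNge.
have hk : `|K| / - h < k%:R by rewrite truncnS_gt.
move: hk; rewrite ltr_pdivrMr ?oppr_gt0 // mulrN => hk.
have := ler_norm K; lra.
Qed.

(* By homogeneity it suffices to compare at integer points near large multiples. *)
Lemma norm_compare N1 N2 (c : R) : is_norm N1 -> is_norm N2 ->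
  (forall z : 'rV[int]_d, c * (l1 z)%:R <= N1 (map_mx intr z) - N2 (map_mx intr z)) ->
  forall x, c * l1norm x <= N1 x - N2 x.
Proof.
move=> n1 n2 H x; rewrite -subr_ge0.
pose e N := \sum_(i < d) N (delta_mx 0 i : 'rV[R]_d).
apply: (@archimedean_ge0 _ (e N1 + e N2 + `|c| * e (@l1norm R d))) => k k0.
pose z : 'rV[int]_d := map_mx Num.floor (k%:R *: x).
have zx i : `|(k%:R *: x - map_mx intr z) 0 i| <= 1.
  rewrite !mxE; have /andP[f1 f2] := floor_itv (k%:R * x 0 i).
  by rewrite ger0_norm ?subr_ge0 // lerBlDr addrC -[X in _ + X]mulr1z -intrD ltW.
have xz i : `|(map_mx intr z - k%:R *: x) 0 i| <= 1.
  by have := zx i; rewrite -[in X in X -> _](opprB (map_mx intr z)) mxE normrN.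
have a1 := is_norm_lip n1 xz; have a2 := is_norm_lip n2 zx.
have a3 := is_norm_lip l1norm_is_norm xz; have a4 := is_norm_lip l1norm_is_norm zx.
have := H z; rewrite -l1norm_intr => Hz.
have h1 : N1 (k%:R *: x) = k%:R * N1 x by rewrite (is_norm_homogeneous n1) ger0_norm.
have h2 : N2 (k%:R *: x) = k%:R * N2 x by rewrite (is_norm_homogeneous n2) ger0_norm.
have h3 : l1norm (k%:R *: x) = k%:R * l1norm x.
  by rewrite (is_norm_homogeneous l1norm_is_norm) ger0_norm.
move: a1 a2 a3 a4; rewrite h1 h2 h3 -/(e N1) -/(e N2) -/(e (@l1norm R d)) => a1 a2 a3 a4.
have a5 : `|c * (l1norm (map_mx intr z : 'rV[R]_d) - k%:R * l1norm x)| <= `|c| * e (@l1norm R d).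
  rewrite normrM ler_wpM2l // ler_norml; apply/andP; split; lra.
have := ler_norm (- (c * (l1norm (map_mx intr z : 'rV[R]_d) - k%:R * l1norm x))).
rewrite normrN; lra.
Qed.
End Norms.

(** * The walk and the potential as random variables *)

Lemma integral_sum_indic (R : realType) (dT : measure_display)
    (T : measurableType dT) (mu : {measure set T -> \bar R}) (I : Type)
    (s : seq I) (c : I -> R) (A : I -> set T) :
  (forall i, 0 <= c i) -> (forall i, measurable (A i)) ->
  (\int[mu]_t (\sum_(i <- s) c i * \1_(A i) t)%:E = \sum_(i <- s) (c i)%:E * mu (A i))%E.
Proof.
move=> c0 mA; under eq_integral do rewrite -sumEFin.
rewrite ge0_integral_sum //; first last.
- by move=> i t _; rewrite lee_fin mulr_ge0.
- by move=> i; apply/measurable_EFinP; apply: measurable_funM.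
apply: eq_bigr => i _; under eq_integral do rewrite EFinM.
rewrite ge0_integralZl_EFin //; last first.
  by apply/measurable_EFinP; exact/measurable_indicP.
by rewrite integral_indic // setIT.
Qed.

Section WalkLaw.
Context (R : realType) (d : nat) (dW : measure_display) (W : measurableType dW)
  (PW : 'rV[int]_d -> probability W R) (S : nat -> W -> 'rV[int]_d).
Hypothesis srwS : simple_random_walk PW S.
Implicit Types (x y z : 'rV[int]_d) (w : W) (p : seq 'rV[int]_d).

Lemma srw_stepE (u v : 'rV[int]_d) :
  srw_step R u v = if v \in nbrs u then (2 * d)%:R^-1 else 0.
Proof. by rewrite /srw_step mem_nbrs l1normE eqz_nat. Qed.

Definition nn_walk x (s : nat -> 'rV[int]_d) :=
  s 0%N = x /\ forall k, s k.+1 \in nbrs (s k).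

(** The exceptional set is covered by countably many cylinders, one for each code of a finite
    lattice sequence that is not a nearest-neighbour path from [x]; each has a vanishing factor in
    [srw_law]. *)
Lemma srw_nn_walk x : {ae PW x, forall w, nn_walk x (fun k => S k w)}.
Proof.
pose ok n (t : seq 'rV[int]_d) := (nth 0 t 0 == x) &&
  all (fun k => nth 0 t k.+1 \in nbrs (nth 0 t k)) (iota 0 n).
pose good m w := forall n t, unpickle m = Some (n, t) ->
  (forall k, (k <= n)%N -> S k w = nth 0 t k) -> ok n t.
have H : {ae PW x, forall w, forall m, good m w}.
  apply: ae_foralln => m; rewrite /good.
  case E : (unpickle m) => [[n t]|]; last by apply: aeW => w.
  case okt : (ok n t); first by apply: aeW => w n' t' [<- <-].
  exists [set w | forall k, (k <= n)%N -> S k w = nth 0 t k]; split.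
  - rewrite [X in measurable X](_ : _ = \bigcap_(k in `I_n.+1) [set w | S k w = nth 0 t k]).
      by apply: fin_bigcap_measurable => // k _; exact: (srw_measurable srwS).
    by apply/seteqP; split => w H k /=; apply: H.
  - apply: etrans (srw_law srwS x n (fun k => t`_k)) _.
    move/negbT: okt; rewrite negb_and => /orP[/negPf ->|]; first by rewrite mul0r.
    rewrite -has_predC => /hasP[k]; rewrite mem_iota add0n /= => kn tk.
    by rewrite (bigD1 (Ordinal kn)) //= srw_stepE (negPf tk) mul0r mulr0.
  - move=> w /= nH; apply: contrapT => tw; apply: nH => n' t' [<- <-] {n' t'} tw'.
    by exfalso; apply: tw.
apply: filterS H => w good_w.
have okw n : ok n (mkseq (fun k => S k w) n.+1).
  apply: (good_w (pickle (n, mkseq (fun k => S k w) n.+1))); first by rewrite pickleK.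
  by move=> k kn; rewrite nth_mkseq.
split; first by have /andP[/eqP] := okw 0%N.
move=> k; have /andP[_ /allP/(_ k)] := okw k.+1.
rewrite mem_iota add0n leq0n ltnSn => /(_ isT).
have k2 : (k < k.+2)%N by rewrite ltnS leqnSn.
by rewrite (nth_mkseq _ _ k2) (nth_mkseq _ _ (ltnSn k.+1)).
Qed.

(** For [p] in [paths n y x] this says that [y] is first hit at time [size p], the sites before
    being those of [p] in order. *)
Definition follows (s : nat -> 'rV[int]_d) y p : bool :=
  mkseq s (size p).+1 == rcons p y.

Lemma follows_cons s y x p :
  follows s y (x :: p) = (s 0%N == x) && follows (fun k => s k.+1) y p.
Proof.
rewrite /follows /= -[mkseq s _]/(s 0%N :: map s (iota 1 (size p).+1)).
rewrite eqseq_cons; congr (_ && (_ == _)).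
by rewrite -[iota 1 _]/(iota (1 + 0) _) iotaDl -map_comp.
Qed.

Lemma follows_head s y n v p : p \in paths n y v -> follows s y p -> s 0%N = v.
Proof.
by move=> /mem_paths[_ _ [q [pq _]]]; rewrite /follows pq => /eqP [].
Qed.

Lemma sum_follows n y x s h (F : seq 'rV[int]_d -> R) : nn_walk x s ->
  s h = y -> (forall k, (k < h)%N -> s k != y) ->
  \sum_(p <- paths n y x) F p * (follows s y p)%:R = (h <= n)%:R * F (mkseq s h).
Proof.
elim: n x s h F => [|n IHn] x s h F [s0 snn] sh hmin /=.
  case: eqP => [xy|xy].
    have -> : h = 0%N.
      by case: h sh hmin => // h _ /(_ 0%N isT); rewrite s0 xy eqxx.
    by rewrite big_seq1 /follows /mkseq /= s0 xy eqxx mulr1 mul1r.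
  rewrite big_nil; case: h sh hmin => [|h _ _]; first by rewrite s0.
  by rewrite mul0r.
case: eqP => [xy|xy].
  have -> : h = 0%N.
    by case: h sh hmin => // h _ /(_ 0%N isT); rewrite s0 xy eqxx.
  by rewrite big_seq1 /follows /mkseq /= s0 xy eqxx mulr1 mul1r.
case: h sh hmin => [|h sh hmin]; first by rewrite s0.
rewrite big_map big_flatten /= big_map.
rewrite (bigD1_seq (s 1%N)) ?uniq_nbrs //=; last by rewrite -s0.
rewrite [X in _ + X]big1_seq ?addr0; last first.
  move=> v /andP[vs1 _]; rewrite big_seq big1 // => p pv.
  rewrite follows_cons; case fo : (follows _ _ _); last by rewrite andbF mulr0.
  by have := follows_head pv fo => vE; rewrite vE eqxx in vs1.
under eq_bigr do rewrite follows_cons s0 eqxx /=.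
rewrite (IHn (s 1%N) (fun k => s k.+1) h (fun p => F (x :: p))) //; last first.
  by move=> k kh; apply: hmin.
rewrite ltnS; congr (_ * F _); rewrite -s0.
by rewrite -[mkseq s h.+1]/(s 0%N :: map s (iota (1 + 0) h)) iotaDl -map_comp.
Qed.

Lemma follows_hit s y p : follows s y p -> s (size p) = y.
Proof.
by move=> /eqP /(congr1 (last 0)); rewrite last_rcons mkseqS last_rcons.
Qed.

Lemma measurable_follows y p : measurable [set w | follows (fun k => S k w) y p].
Proof.
rewrite [X in measurable X](_ : _ =
  \bigcap_(k in `I_(size p).+1) [set w | S k w = nth 0 (rcons p y) k]).
  by apply: fin_bigcap_measurable => // k _; exact: (srw_measurable srwS).
apply/seteqP; split => w /=.
  by rewrite /follows => /eqP E k /= kp; rewrite -E nth_mkseq.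
move=> E; apply/eqP/(@eq_from_nth _ 0); first by rewrite size_mkseq size_rcons.
by move=> k; rewrite size_mkseq => kp; rewrite nth_mkseq // E.
Qed.

Lemma srw_follows n y x p : p \in paths n y x ->
  PW x [set w | follows (fun k => S k w) y p] = ((2 * d)%:R^-1 ^+ size p)%:E.
Proof.
move=> /mem_paths[_ _ [q [pq aq]]].
have sq : size q = size p by have := congr1 size pq; rewrite size_rcons => -[].
rewrite [X in PW x X](_ : _ =
  [set w | forall k, (k <= size p)%N -> S k w = nth 0 (rcons p y) k]).
  rewrite (srw_law srwS) pq /= eqxx mul1r; congr EFin.
  rewrite -[X in _ ^+ X]card_ord -prodr_const; apply: eq_bigr => k _.
  rewrite srw_stepE; move/(pathP 0): aq => /(_ k); rewrite sq => /(_ (ltn_ord k)).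
  by rewrite /adj => ->.
apply/seteqP; split => w /=.
  by rewrite /follows => /eqP E k kp; rewrite -E nth_mkseq.
move=> E; apply/eqP/(@eq_from_nth _ 0); first by rewrite size_mkseq size_rcons.
by move=> k; rewrite size_mkseq => kp; rewrite nth_mkseq // E.
Qed.

Lemma measurable_site (g : 'rV[int]_d -> R) k : measurable_fun setT (fun w => g (S k w)).
Proof.
move=> _ B mB; rewrite setTI.
rewrite [X in measurable X](_ : _ =
  \bigcup_z (if `[< B (g z) >] then [set w | S k w = z] else set0)).
  apply: countable_bigcupT_measurable; first exact: countableP.
  by move=> z; case: ifP => _; [exact: (srw_measurable srwS)|exact: measurable0].
apply/seteqP; split => w /=.
  by move=> Bw; exists (S k w) => //=; rewrite asboolT.
by move=> [z _]; case: ifP => [/asboolP Bz /= ->|_ []].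
Qed.

Lemma hitting_timeP y w : (exists2 h, hitting_time S y w = Some h &
    S h w = y /\ forall k, (k < h)%N -> S k w != y) \/
  (hitting_time S y w = None /\ forall k, S k w != y).
Proof.
rewrite /hitting_time; case: pselect => [ex_hit|no_hit].
  left; exists (ex_minn ex_hit) => //; case: ex_minnP => h /eqP hy hmin; split => //.
  by move=> k kh; apply/negP => /hmin; rewrite leqNgt kh.
by right; split => // k; apply/negP => ky; apply: no_hit; exists k.
Qed.

Lemma measurable_travel_weight y (om : 'rV[int]_d -> R) :
  measurable_fun setT (fun w => (travel_weight S y om w)%:E).
Proof.
(* Nonzero only if [h] is the first hitting time of [y], so the partial sums are eventually
   constant; each term reads finitely many positions. *)
pose a h w : R := \prod_(k < h) (if S k w == y then 0 else expR (- om (S k w))) *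
   (S h w == y)%:R.
apply: (@emeasurable_fun_cvg _ _ _ _ (fun N w => (\sum_(h < N) a h w)%:E)).
  move=> N; apply/measurable_EFinP; apply: measurable_sum => h.
  apply: measurable_funM; last exact: (measurable_site (fun z => (z == y)%:R)).
  apply: measurable_prod => k _.
  exact: (measurable_site (fun z => if z == y then 0 else expR (- om z))).
move=> w _; have [[h hE [hy hmin]]|[hE nohit]] := hitting_timeP y w.
  apply: (@cvg_near_cst _ _ _ _ _ _); exists h.+1 => // N /= hN.
  rewrite /travel_weight hE (bigD1 (Ordinal hN)) //= big1 ?addr0 => [|i ih].
    rewrite /a hy eqxx mulr1 -sumrN expR_sum big_mkord.
    by congr EFin; apply: eq_bigr => k _; rewrite (negPf (hmin _ (ltn_ord k))).
  rewrite /a; have [ih'|hi] := ltnP i h; first by rewrite (negPf (hmin _ ih')) mulr0.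
  have {}hi : (h < i)%N.
    by rewrite ltn_neqAle hi andbT; apply: contra ih => /eqP hi'; apply/eqP/val_inj.
  by rewrite (bigD1 (Ordinal hi)) //= hy eqxx !mul0r.
apply: (@cvg_near_cst _ _ _ _ _ _); exists 0%N => // N /= _.
rewrite /travel_weight hE big1 // => i _.
by rewrite /a (negPf (nohit _)) mulr0.
Qed.

(** [psum N] is the mean of the travel weight on the event that [y] is hit within [N] steps;
    dominated convergence with bound 1. *)
Lemma travel_e_cvg x y (om : 'rV[int]_d -> R) : (forall z, 0 <= om z) ->
  (psum N y (fun z => expR (- om z)) x)%:E @[N --> \oo] --> travel_e PW S x y om.
Proof.
move=> om0; rewrite /travel_e unlock.
pose F p : R := \prod_(z <- p) expR (- om z).
have F0 p : 0 <= F p by apply: prodr_ge0 => z _; exact: expR_ge0.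
pose f N w : R := \sum_(p <- paths N y x) F p * (follows (fun k => S k w) y p)%:R.
have indic_follows p w : \1_[set w | follows (fun k => S k w) y p] w =
    (follows (fun k => S k w) y p)%:R :> R.
  by rewrite indicE; case E : (follows _ _ _); [rewrite mem_set|rewrite memNset //= E].
have mfol p : measurable_fun setT (fun w => (follows (fun k => S k w) y p)%:R : R).
  rewrite -(funext (indic_follows p)).
  by apply/measurable_indicP; exact: measurable_follows.
have fE N : (\int[PW x]_w (f N w)%:E)%E = (psum N y (fun z => expR (- om z)) x)%:E.
  have -> : (fun w => (f N w)%:E) = fun w => (\sum_(p <- paths N y x)
       F p * \1_[set w | follows (fun k => S k w) y p] w)%:E.
    apply/funext => w; congr EFin; apply: eq_bigr => p _; congr (_ * _).
    by rewrite indic_follows.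
  rewrite integral_sum_indic //; last by move=> p; exact: measurable_follows.
  rewrite /psum -sumEFin big_seq [RHS]big_seq; apply: eq_bigr => p pp.
  transitivity ((F p)%:E * ((2 * d)%:R^-1 ^+ size p)%:E)%E.
    by congr (_ * _)%E; exact: srw_follows pp.
  rewrite -EFinM; congr EFin.
  rewrite /pweight big_split /= [X in _ = _ * X]big_const_seq count_predT.
  by rewrite iter_mulr_1.
have fw w N : nn_walk x (fun k => S k w) ->
    f N w = if hitting_time S y w is Some h
            then (h <= N)%:R * travel_weight S y om w else 0.
  move=> nnw; have [[h hE [hy hmin]]|[hE nohit]] := hitting_timeP y w; rewrite hE.
    rewrite /f (sum_follows _ _ nnw hy hmin); congr (_ * _).
    rewrite /travel_weight hE /F -sumrN expR_sum.
    by rewrite /mkseq big_map /index_iota subn0.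
  rewrite /f big1 // => p _; case fo : (follows _ _ _); last by rewrite mulr0.
  by have := nohit (size p); rewrite (follows_hit fo) eqxx.
have tw01 w : 0 <= travel_weight S y om w <= 1.
  rewrite /travel_weight; case: (hitting_time _ _ _) => [h|]; last by rewrite lexx ler01.
  by rewrite expR_ge0 /= -expR0 ler_expR oppr_le0 sumr_ge0.
rewrite -(funext fE).
have [|||||_ _ cvg_int] := @dominated_convergence _ _ _ (PW x) setT measurableT
  (fun N w => (f N w)%:E) (fun w => (travel_weight S y om w)%:E) (cst 1%E).
- move=> N; apply/measurable_EFinP; apply: measurable_sum => p.
  by apply: measurable_funM => //; exact: mfol.
- exact: measurable_travel_weight.
- apply: filterS (srw_nn_walk x) => w nnw _.
  rewrite (_ : (fun N => _) = fun N => (if hitting_time S y w is Some h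
            then (h <= N)%:R * travel_weight S y om w else 0)%:E); last first.
    by apply/funext => N; rewrite fw.
  case hE : (hitting_time S y w) => [h|].
    by apply: (@cvg_near_cst _ _ _ _ _ _); exists h => // N /= hN; rewrite hN mul1r.
  by rewrite /travel_weight hE; exact: cvg_cst.
- exact: finite_measure_integrable_cst.
- apply: filterS (srw_nn_walk x) => w nnw N _; rewrite fw //= lee_fin.
  have /andP[t0 t1] := tw01 w.
  case: (hitting_time S y w) => [h|]; last by rewrite normr0.
  by case: (h <= N)%N; rewrite ?mul1r ?mul0r ?normr0 ?ger0_norm.
exact: cvg_int.
Qed.

End WalkLaw.

(** * The Bernoulli environment and the limit of an infinite horizon *)

Section Environment.
Context (R : realType) (d : nat) (dO : measure_display) (Omega : measurableType dO)
  (Q : probability Omega R) (omega : 'rV[int]_d -> {mfun Omega >-> R}) (r : R).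
Hypothesis bernQ : bernoulli_potential Q omega r.
Hypothesis omega_ge0 : forall z o, 0 <= omega z o.
Implicit Types (x y z : 'rV[int]_d) (o : Omega) (s : seq 'rV[int]_d).
Implicit Types (sigma eta : 'rV[int]_d -> bool) (t : seq ('rV[int]_d * bool)).

Definition obst o z : bool := omega z o != 0.

Definition bern (b : bool) : R := if b then 1 - r else r.

Definition agrees sigma t : bool := all (fun zb => sigma zb.1 == zb.2) t.

Fixpoint patterns s : seq (seq ('rV[int]_d * bool)) :=
  if s is z :: s'
  then [seq (z, false) :: t | t <- patterns s'] ++ [seq (z, true) :: t | t <- patterns s']
  else [:: [::]].

Definition upds t eta : 'rV[int]_d -> bool := foldl (fun f zb => upd f zb.1 zb.2) eta t.

Lemma patterns_keys s t : t \in patterns s -> unzip1 t = s.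
Proof.
elim: s t => [|z s IHs] t /=; first by rewrite inE => /eqP ->.
by rewrite mem_cat => /orP[] /mapP[t' /IHs <- ->].
Qed.

Lemma bexp_patterns s (G : ('rV[int]_d -> bool) -> R) eta :
  bexp r s G eta = \sum_(t <- patterns s) G (upds t eta) * \prod_(zb <- t) bern zb.2.
Proof.
elim: s eta => [|z s IHs] eta /=; first by rewrite big_seq1 big_nil mulr1.
rewrite big_cat !big_map !IHs !mulr_sumr /=.
by congr (_ + _); apply: eq_bigr => t _; rewrite big_cons /= mulrCA.
Qed.

Lemma glue_patterns s (G : ('rV[int]_d -> bool) -> R) sigma eta : uniq s ->
  G (fun z => if z \in s then sigma z else eta z) =
  \sum_(t <- patterns s) G (upds t eta) * (agrees sigma t)%:R.
Proof.
elim: s eta => [|z s IHs] eta /=; first by rewrite big_seq1 mulr1.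
move=> /andP[zs us]; rewrite big_cat !big_map /=.
transitivity (\sum_(t <- patterns s) G (upds t (upd eta z (sigma z))) * (agrees sigma t)%:R).
  rewrite -IHs //; congr G; apply/funext => x; rewrite inE /upd.
  by case: eqP => //= ->; rewrite (negPf zs).
rewrite -big_split /=; apply: eq_bigr => t _; rewrite /agrees /=.
by case: (sigma z); rewrite /= ?mulr0 ?add0r ?addr0.
Qed.

Lemma measurable_omega z a : measurable [set o | omega z o = a].
Proof. by have := @measurable_funPTI _ _ _ _ (omega z) [set a] (measurable_set1 _). Qed.

Lemma obst_set z b : [set o | obst o z = b] =
  if b then ~` [set o | omega z o = 0] else [set o | omega z o = 0].
Proof.
case: b; apply/seteqP; split => o /=; rewrite /obst.
- by move/eqP.
- by move/eqP.
- by move/negbFE/eqP.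
- by move=> ->; rewrite eqxx.
Qed.

Lemma bern_obst z b : Q [set o | obst o z = b] = (bern b)%:E.
Proof.
rewrite obst_set; case: b => /=; last exact: (bernoulli_potential0 bernQ z).
apply: etrans (probability_setC _ (measurable_omega z 0)) _.
by rewrite (bernoulli_potential0 bernQ z) EFinB.
Qed.

Lemma bern_agrees t : uniq (unzip1 t) ->
  Q [set o | agrees (obst o) t] = (\prod_(zb <- t) bern zb.2)%:E.
Proof.
move=> ut.
pose B z : set R := if (z, true) \in t then ~` [set 0] else [set 0].
have key z b : (z, b) \in t -> forall b', (z, b') \in t -> b' = b.
  elim: t ut {B} => //= -[z1 b1] t IHt /andP[z1t ut]; rewrite !inE.
  have nk b2 : (z1, b2) \notin t by apply: contra z1t => /(map_f fst).
  move=> /predU1P[[-> ->]|zbt] b'; rewrite !inE => /predU1P[[]|].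
  - by [].
  - by rewrite (negPf (nk _)).
  - by move=> zz1; rewrite zz1 (negPf (nk _)) in zbt.
  - exact: IHt.
have BE z b : (z, b) \in t -> forall o, B z (omega z o) <-> obst o z = b.
  move=> zbt o; rewrite /B /obst; case: ifPn => zt /=.
    by rewrite (key _ _ zt _ zbt); split => /eqP.
  have -> : b = false by case: b zbt zt => // ->.
  by split => [->|/negbT]; rewrite ?eqxx // negbK => /eqP.
have mB z : measurable (B z).
  by rewrite /B; case: ifP => _; [apply: measurableC|]; exact: measurable_set1.
have := bernoulli_potential_independent bernQ ut mB.
rewrite [X in Q X = _ -> _](_ : _ = [set o | agrees (obst o) t]).
  move=> ->; rewrite big_map -prodEFin big_seq [RHS]big_seq.
  apply: eq_bigr => -[z b] zbt /=; rewrite -(bern_obst z b); congr (Q _).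
  by apply/seteqP; split => o /=; move/(BE z b zbt).
apply/seteqP; split => o /=.
  move=> H; apply/allP => -[z b] zbt /=; apply/eqP/(BE z b zbt)/H => /=.
  by apply/mapP; exists (z, b).
by move=> /allP H z /= /mapP[[z' b] zbt ->] /=; have /eqP/(BE z' b zbt) := H _ zbt.
Qed.

Lemma measurable_agrees t : measurable [set o | agrees (obst o) t].
Proof.
elim: t => [|[z b] t IHt].
  by rewrite [X in measurable X](_ : _ = setT) //; apply/seteqP; split.
rewrite [X in measurable X](_ : _ = [set o | obst o z = b] `&` [set o | agrees (obst o) t]).
  apply: measurableI => //; rewrite obst_set.
  by case: b; [apply: measurableC|]; exact: measurable_omega.
apply/seteqP; split => o /=; rewrite /agrees /=; first by move=> /andP[/eqP].
by move=> [-> ->]; rewrite eqxx.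
Qed.

(** Being determined by [s], [G] is a finite combination of indicators of patterns on [s], whose
    probabilities factor by independence. *)
Lemma integral_bexp s (G : ('rV[int]_d -> bool) -> R) eta : uniq s ->
  (forall sigma, 0 <= G sigma) ->
  (forall sigma sigma', {in s, sigma =1 sigma'} -> G sigma = G sigma') ->
  (\int[Q]_o (G (obst o))%:E)%E = (bexp r s G eta)%:E.
Proof.
move=> us G0 Gs.
have -> : (fun o => (G (obst o))%:E) = fun o =>
    (\sum_(t <- patterns s) G (upds t eta) * \1_[set o | agrees (obst o) t] o)%:E.
  apply/funext => o; congr EFin.
  rewrite (Gs _ (fun z => if z \in s then obst o z else eta z)); last by move=> z ->.
  rewrite glue_patterns //; apply: eq_bigr => t _; congr (_ * _); rewrite indicE.
  by case E : (agrees _ _); [rewrite mem_set|rewrite memNset //= E].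
rewrite integral_sum_indic //; last by move=> t; exact: measurable_agrees.
rewrite bexp_patterns -sumEFin big_seq [RHS]big_seq; apply: eq_bigr => t tp.
by rewrite EFinM; congr (_ * _)%E; apply: bern_agrees; rewrite (patterns_keys tp).
Qed.

Lemma ae_bernoulli01 : {ae Q, forall o, forall z, omega z o = 0 \/ omega z o = 1}.
Proof.
have H : {ae Q, forall o, forall m, forall z, unpickle m = Some z ->
    omega z o = 0 \/ omega z o = 1}.
  apply: ae_foralln => m; case: (unpickle m) => [z|]; last exact: aeW.
  exists (~` ([set o | omega z o = 0] `|` [set o | omega z o = 1])); split.
  - by apply: measurableC; apply: measurableU; exact: measurable_omega.
  - have mU : measurable ([set o | omega z o = 0] `|` [set o | omega z o = 1]).
      by apply: measurableU; exact: measurable_omega.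
    apply: etrans (probability_setC _ mU) _.
    rewrite measureU; [|exact: measurable_omega|exact: measurable_omega|].
      transitivity (1 - (r%:E + (1 - r)%:E))%E.
        congr (1 - (_ + _))%E; first exact: (bernoulli_potential0 bernQ z).
        exact: (bernoulli_potential1 bernQ z).
      by rewrite -EFinD subrKC subrr.
    apply/seteqP; split => o //= [->] /esym/eqP; by rewrite oner_eq0.
  - by move=> o /= + z01; apply => z' [<-].
by apply: filterS H => o ho z; apply: (ho (pickle z)); rewrite pickleK.
Qed.

Variables (dW : measure_display) (W : measurableType dW)
  (PW : 'rV[int]_d -> probability W R) (S : nat -> W -> 'rV[int]_d).
Hypothesis srwS : simple_random_walk PW S.
Hypothesis d_gt0 : (0 < d)%N.

Lemma measurable_psum n y x : measurable_fun setT
  (fun o => psum n y (fun z => expR (- omega z o)) x).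
Proof.
apply: measurable_sum => p; apply: measurable_prod => z _.
apply: measurable_funM => //; apply: measurableT_comp => //.
exact: measurableT_comp.
Qed.

(** The shift by the distance makes every path sum positive; by monotonicity in the horizon the
    limit is positive too, and [ln] is continuous there. *)
Lemma travel_cost_cvg y x o :
  (- ln (psum (n + l1 (x - y)) y (fun z => expR (- omega z o)) x))%:E @[n --> \oo] -->
  travel_cost PW S x y (omega ^~ o).
Proof.
set L := l1 (x - y); set w := fun z => expR (- omega z o).
have w0 z : 0 < w z by exact: expR_gt0.
have w1 z : w z <= 1 by rewrite -expR0 ler_expR oppr_le0.
have w0' z := ltW (w0 z).
have cv : (psum (n + L) y w x)%:E @[n --> \oo] --> travel_e PW S x y (omega ^~ o).
  have := travel_e_cvg srwS (x:=x) (y:=y) (fun z => omega_ge0 z o).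
  by rewrite -(cvg_shiftn L).
have mono n : psum L y w x <= psum (n + L) y w x.
  by elim: n => // n IHn; apply: le_trans IHn _; rewrite addSn; exact: psum_leS.
have pos n : 0 < psum (n + L) y w x by apply: psum_pos; rewrite // leq_addl.
have le1 n : psum (n + L) y w x <= 1 by exact: psum_le1.
have eL : ((psum L y w x)%:E <= travel_e PW S x y (omega ^~ o))%E.
  rewrite -(cvg_lim _ cv) //; apply: lime_ge; first by apply/cvg_ex; eexists; exact: cv.
  by apply: nearW => n; rewrite lee_fin.
have e1 : (travel_e PW S x y (omega ^~ o) <= 1)%E.
  rewrite -(cvg_lim _ cv) //; apply: lime_le; first by apply/cvg_ex; eexists; exact: cv.
  by apply: nearW => n; rewrite lee_fin.
rewrite /travel_cost; move: cv eL e1.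
case: (travel_e _ _ _ _ _) => [e| |] cv; rewrite ?leeNy_eq ?leye_eq // => eL e1.
have e0 : 0 < e by apply: lt_le_trans (pos 0%N) _; rewrite add0n -lee_fin.
rewrite lne_EFin //.
have /fine_cvgP[_ cvR] := cv.
have lncv : - ln (psum (n + L) y w x) @[n --> \oo] --> - ln e.
  by apply: cvgN; exact: (cvg_comp _ (@ln R) cvR (continuous_ln e0)).
by apply: cvg_EFin; [exact: nearW|exact: lncv].
Qed.

(** Dominated convergence; the dominating constant is the cost of one shortest path through
    obstacles only, whatever the horizon. *)
Lemma mean_cost_cvg y x : 0 <= r <= 1 ->
  (mean_cost (n + l1 (x - y)) y x r)%:E @[n --> \oo] -->
  (\int[Q]_o travel_cost PW S x y (omega ^~ o))%E.
Proof.
move=> r01; set L := l1 (x - y).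
have i0 : 'I_d by exact: (Ordinal d_gt0).
pose f n o := (- ln (psum (n + L) y (fun z => expR (- omega z o)) x))%:E.
have mf n : measurable_fun setT (f n).
  apply/measurable_EFinP; apply: measurableT_comp => //.
  by apply: measurableT_comp; [exact: measurable_ln|exact: measurable_psum].
have ff o : setT o -> f ^~ o @ \oo --> travel_cost PW S x y (omega ^~ o).
  by move=> _; exact: travel_cost_cvg.
have costE o n : (forall z, omega z o = 0 \/ omega z o = 1) ->
    f n o = (cost R (n + L) y (obst o) x)%:E.
  move=> o01; rewrite /f /cost; congr (- ln (psum _ _ _ _))%:E.
  apply/funext => z; rewrite /bweight /obst.
  by case: (o01 z) => ->; rewrite ?eqxx ?oppr0 ?expR0 // oner_eq0.
have fE n : (\int[Q]_o f n o)%E = (mean_cost (n + L) y x r)%:E.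
  rewrite /mean_cost -integral_bexp.
  - apply: ae_eq_integral => //.
    + apply/measurable_EFinP; apply: measurableT_comp => //.
      apply: measurableT_comp; first exact: measurable_ln.
      apply: measurable_sum => p; apply: measurable_prod => z _.
      apply: measurable_funM => //.
      rewrite (_ : (fun o => _) = fun o => expR (-1) + (1 - expR (-1)) *
          \1_[set o | omega z o = 0] o).
        apply: measurable_funD => //; apply: measurable_funM => //.
        by apply/measurable_indicP; exact: measurable_omega.
      apply/funext => o; rewrite indicE /bweight /obst; case: eqP => /= o0.
        by rewrite mem_set // mulr1 subrKC.
      by rewrite memNset // mulr0 addr0.
    + by apply: filterS ae_bernoulli01 => o o01 _; exact: costE.
  - exact: uniq_sites.
  - by move=> sigma; exact: cost_ge0.
  - move=> sigma sigma' ss'; rewrite /cost; congr (- ln _).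
    apply: eq_big_seq => p pp; apply: eq_big_seq => z zp; congr (_ * _).
    by rewrite /bweight ss' //; exact: (sub_sites pp).
rewrite -(funext fE).
pose K : R := L%:R * (1 + ln (2 * d)%:R).
have [|||||_ _ cvg_int] := @dominated_convergence _ _ _ Q setT measurableT
  f (fun o => travel_cost PW S x y (omega ^~ o)) (cst K%:E).
- exact: mf.
- exact: (emeasurable_fun_cvg f).
- by apply: aeW => o; exact: ff.
- exact: finite_measure_integrable_cst.
- apply: filterS ae_bernoulli01 => o o01 n _; rewrite costE //= lee_fin.
  rewrite ger0_norm; last exact: (cost_ge0 R i0).
  by apply: (cost_le R i0); rewrite leq_addl.
exact: cvg_int.
Qed.

End Environment.

(** * Lyapunov exponents *)

Lemma cvg_ge_near (R : realType) (u : nat -> R) (c l : R) :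
  u @ \oo --> l -> (\forall n \near \oo, c <= u n) -> c <= l.
Proof.
by move=> ul cu; rewrite -(cvg_lim _ ul) //; apply: limr_ge => //; apply/cvg_ex; exists l.
Qed.

(** Serves both parts: [c] may be negative, and the upper bound is the case of exchanged parameters.
    The restriction [x != y] lets an additive constant be absorbed into the distance. *)
Lemma lyapunov_compare (R : realType) (d : nat) (dW : measure_display)
    (W : measurableType dW) (PW : 'rV[int]_d -> probability W R)
    (S : nat -> W -> 'rV[int]_d) (dO : measure_display)
    (Omega : measurableType dO) (Qp Qq : probability Omega R)
    (omega : 'rV[int]_d -> {mfun Omega >-> R}) (p q c : R)
    (ap aq : 'rV[R]_d -> R) :
  (0 < d)%N -> simple_random_walk PW S -> (forall z o, 0 <= omega z o) ->
  0 <= p <= 1 -> 0 <= q <= 1 ->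
  bernoulli_potential Qp omega p -> bernoulli_potential Qq omega q ->
  quenched_lyapunov_exponent PW S Qp omega ap ->
  quenched_lyapunov_exponent PW S Qq omega aq ->
  (forall (N : nat) (y x : 'rV[int]_d), (l1 (x - y) <= N)%N -> x != y ->
     c * (l1 (x - y))%:R <= mean_cost N y x p - mean_cost N y x q) ->
  forall x, c * l1norm x <= ap x - aq x.
Proof.
move=> d0 srwS om0 p01 q01 Bp Bq [np limp _] [nq limq _] H.
have i0 : 'I_d by exact: (Ordinal d0).
apply: norm_compare => // z.
have [->|z0] := eqVneq z 0.
  have /eqP -> : l1 (0 : 'rV[int]_d) == 0%N by rewrite l1_eq0.
  by rewrite map_mx0 !is_norm0 // mulr0 subrr.
pose I (Q : probability Omega R) n := (\int[Q]_o travel_cost PW S 0 (z *+ n) (omega ^~ o))%E.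
have step n : (0 < n)%N -> exists a b : R, [/\ I Qp n = a%:E, I Qq n = b%:E &
    c * (n * l1 z)%:R <= a - b].
  move=> n0; set y := z *+ n.
  have l1n : l1 (0 - y) = (n * l1 z)%N.
    by rewrite sub0r l1N l1Mn.
  have cp := mean_cost_cvg Bp om0 srwS d0 (y := y) (x := 0) p01.
  have cq := mean_cost_cvg Bq om0 srwS d0 (y := y) (x := 0) q01.
  have fin r (Q : probability Omega R) : 0 <= r <= 1 ->
     (mean_cost (n0 + l1 (0 - y)) y 0 r)%:E @[n0 --> \oo] --> I Q n ->
     exists a, I Q n = a%:E.
    move=> r01 cvr; pose K : R := (l1 (0 - y))%:R * (1 + ln (2 * d)%:R).
    have bnd k : 0 <= mean_cost (k + l1 (0 - y)) y 0 r <= K.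
      apply/andP; split; first by apply: bexp_ge0 => // s; exact: (cost_ge0 R i0).
      rewrite -[leRHS](bexp_cst r (sites (k + l1 (0 - y)) y 0) K (fun=> true)).
      by apply: bexp_le => // s; apply: (cost_le R i0); rewrite leq_addl.
    have lo : (0%:E <= I Q n)%E.
      rewrite -(cvg_lim _ cvr) //; apply: lime_ge; first by apply/cvg_ex; eexists; exact: cvr.
      by apply: nearW => k; rewrite lee_fin; case/andP: (bnd k).
    have hi : (I Q n <= K%:E)%E.
      rewrite -(cvg_lim _ cvr) //; apply: lime_le; first by apply/cvg_ex; eexists; exact: cvr.
      by apply: nearW => k; rewrite lee_fin; case/andP: (bnd k).
    exists (fine (I Q n)); rewrite fineK //.
    by rewrite ge0_fin_numE // (le_lt_trans hi) // ltry.
  have [a aE] := fin p Qp p01 cp; have [b bE] := fin q Qq q01 cq.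
  exists a, b; split => //.
  move: cp cq; rewrite -/(I Qp n) -/(I Qq n) aE bE => /fine_cvgP[_ cp] /fine_cvgP[_ cq].
  rewrite -l1n.
  have cpq : (fun k => mean_cost (k + l1 (0 - y)) y 0 p -
      mean_cost (k + l1 (0 - y)) y 0 q) @ \oo --> a - b by exact: cvgB cp cq.
  apply: (cvg_ge_near cpq); apply: nearW => k; apply: H; first exact: leq_addl.
  by rewrite -subr_eq0 -l1_eq0 l1n muln_eq0 negb_or -lt0n n0 /= l1_eq0 z0.
pose A n := fine (mean_travel_cost PW S Qp omega z n).
pose B n := fine (mean_travel_cost PW S Qq omega z n).
have /fine_cvgP[_ cA] := limp z; have /fine_cvgP[_ cB] := limq z.
have cAB : (fun n => A n - B n) @ \oo -->
  ap (map_mx intr z) - aq (map_mx intr z) by exact: cvgB cA cB.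
apply: (cvg_ge_near cAB); exists 1%N => // n /= n0.
have [a [b [aE bE ab]]] := step n n0.
have -> : A n = n%:R^-1 * a by rewrite -[A n]/(fine ((n%:R^-1)%:E * I Qp n)) aE.
have -> : B n = n%:R^-1 * b by rewrite -[B n]/(fine ((n%:R^-1)%:E * I Qq n)) bE.
rewrite -mulrBr.
by rewrite ler_pdivlMl ?ltr0n // mulrCA -natrM.
Qed.

Theorem theorem1p2 (R : realType) (d : nat) (d_ge1 : (1 <= d)%N)
    (* the simple random walk on Z^d, with laws PW x *)
    (dW : measure_display) (W : measurableType dW)
    (PW : 'rV[int]_d -> probability W R) (S : nat -> W -> 'rV[int]_d)
    (srwS : simple_random_walk PW S)
    (* the potential, with laws Q r *)
    (dO : measure_display) (Omega : measurableType dO)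
    (Q : R -> probability Omega R)
    (omega : 'rV[int]_d -> {mfun Omega >-> R})
    (omega_ge0 : forall z o, 0 <= omega z o)
    (omegaB : forall r : R, 0 <= r <= 1 -> bernoulli_potential (Q r) omega r)
    (* the quenched Lyapunov exponents *)
    (alpha : R -> 'rV[R]_d -> R)
    (alphaL : forall r : R, 0 < r < 1 ->
       quenched_lyapunov_exponent PW S (Q r) omega (alpha r)) :
  (forall p q : R, 0 < p -> p < q -> q < 1 ->
     (((1 - expR (-1)) * (q - p))%:E <=
      ereal_inf [set ((alpha p x - alpha q x) / l1norm x)%:E
                | x in [set x : 'rV[R]_d | x != 0%R]])%E)
  /\
  (forall q0 : R, 0 < q0 -> q0 < 1 ->
     exists C : R, 0 < C /\
       forall p q : R, 0 < p -> p < q -> q <= q0 ->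
         (ereal_sup [set ((alpha p x - alpha q x) / l1norm x)%:E
                    | x in [set x : 'rV[R]_d | x != 0%R]] <=
          (C * (q - p))%:E)%E).
Proof.
have i0 : 'I_d by exact: (Ordinal d_ge1).
have norm_gt0 (x : 'rV[R]_d) : x != 0 -> 0 < l1norm x.
  move=> x0; rewrite lt_neqAle is_norm_ge0 ?andbT; last exact: l1norm_is_norm.
  by rewrite eq_sym; apply: contra x0 => /eqP /(is_norm_definite (l1norm_is_norm R d)) ->.
split=> [p q p0 pq q1|q0 q00 q01].
  have q0 := lt_trans p0 pq; have p1 := lt_trans pq q1.
  apply: le_ereal_inf_tmp => _ [x x0 <-]; rewrite lee_fin ler_pdivlMr ?norm_gt0 //.
  apply: (lyapunov_compare d_ge1 srwS omega_ge0 _ _ (omegaB p _) (omegaB q _)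
     (alphaL p _) (alphaL q _));
    rewrite ?p0 ?q0 ?(ltW p0) ?(ltW p1) ?(ltW q0) ?(ltW q1) ?p1 ?q1 //.
  move=> N y z zyN _; apply: (mean_cost_diff_ge i0) => //; exact: ltW.
have q0b : 0 < q0 < 1 by rewrite q00.
have [C C0 HC] := mean_cost_diff_le i0 q0b.
(* The factor 2 absorbs the additive 1, distinct lattice points being at distance at least 1. *)
exists (2 * C); split; first by rewrite mulr_gt0.
move=> p q p0 pq qq0.
have q0' := lt_trans p0 pq; have q1 := le_lt_trans qq0 q01; have p1 := lt_trans pq q1.
apply: ge_ereal_sup => _ [x x0 <-]; rewrite lee_fin ler_pdivrMr ?norm_gt0 //.
rewrite -lerN2 opprB -mulNr.
apply: (lyapunov_compare d_ge1 srwS omega_ge0 _ _ (omegaB q _) (omegaB p _)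
     (alphaL q _) (alphaL p _));
  rewrite ?p0 ?q0' ?(ltW p0) ?(ltW p1) ?(ltW q0') ?(ltW q1) ?p1 ?q1 //.
move=> N y z zyN zy.
rewrite -[leRHS]opprB mulNr lerN2; apply: le_trans (HC p q N y z zyN p0 pq qq0) _.
have l1z : 1 <= (l1 (z - y))%:R :> R by rewrite ler1n lt0n l1_eq0 subr_eq0.
have : 0 <= C * (q - p) by rewrite mulr_ge0 ?subr_ge0 // ltW.
nra.
Qed.
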